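(* Let $p$ be an odd prime, let $q$ be a power of $p$, let $N, l, i$ be positive integers, let $f \in \mathbb{F}_q[T_1,\ldots,T_N]$, and let $F \in \mathbb{Z}_q[T_1,\ldots,T_N]$ be a lift of $f$ (i.e. the coefficientwise reduction of $F$ modulo $p$ is $f$). Let $X$ be the double cover of the torus $\mathbb{G}_{m,\mathbb{F}_q}^N$ given by $w^2 = f$. Let $b$ be an odd integer such that $b(q-1)/2 \geq l$, and put $A^{(l)}_{b,k} := \big(\big(P_b^{(l)}\big)^{-1}\big)_{1,k}$ for $k=1,\ldots,l$. Then $$\Phi := \sum_{k=1}^l A^{(l)}_{b,k} \cdot N_{\mathbb{Z}_{q^i}/\mathbb{Z}_q}F^{(b+2k-2)(q-1)/2}$$ is an Eulerian function for $X(\mathbb{F}_{q^i})$ modulo $p^l$.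
   Context: For $i \geq 1$, $\mu_{q^i-1}$ denotes the group of $(q^i-1)$-th roots of unity (in an algebraic closure of $\mathbb{Q}_p$), $\mathbb{Z}_{q^i}$ is the ring of integers of the unramified extension $\mathbb{Q}_p(\mu_{q^i-1})$ of $\mathbb{Q}_p$, with residue field $\mathbb{F}_{q^i}$, and $\pi\colon \mathbb{Z}_{q^i} \to \mathbb{F}_{q^i}$ is the residue map, which maps $\mu_{q^i-1}$ bijectively onto $\mathbb{F}_{q^i}^*$. One has $\mathbb{Z}_q \subseteq \mathbb{Z}_{q^i}$. For a polynomial $g$ and $n \geq 1$, the quasi power is $g^{(n)}(T_1,\ldots,T_N) := g(T_1^n,\ldots,T_N^n)$. For $g \in \mathbb{Z}_q[T_1,\ldots,T_N]$, the quasi norm is $$N_{\mathbb{Z}_{q^i}/\mathbb{Z}_q} g := g \cdot g^{(q)} \cdot g^{(q^2)} \cdots g^{(q^{i-1})} \in \mathbb{Z}_q[T_1,\ldots,T_N].$$ The notation $N_{\mathbb{Z}_{q^i}/\mathbb{Z}_q}F^{m}$ means the quasi norm of $F^m$ (equivalently the $m$-th power of the quasi norm of $F$). For $(z_1,\ldots,z_N) \in \mu_{q^i-1}^N$, the value $N_{\mathbb{Z}_{q^i}/\mathbb{Z}_q} g(z_1,\ldots,z_N)$ lies in $\mathbb{Z}_q$, so such polynomials define functions $\mu_{q^i-1}^N \to \mathbb{Z}_q$ by evaluation. For integers $l>0$ and $b$, $P_b^{(l)} \in M_{l \times l}(\mathbb{Q})$ is the matrix whose entry in row $j$ and column $k$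 ($1 \le j,k \le l$) is the binomial coefficient $\binom{b+2(j-1)}{k-1}$. It is invertible, and the entries of its inverse are $p$-adic integers for $p$ odd. A function $\Phi\colon \mu_{q^i-1}^N \to \mathbb{Z}_q$ is called an Eulerian function for $X(\mathbb{F}_{q^i})$ modulo $p^l$ if, for every $(z_1,\ldots,z_N) \in \mu_{q^i-1}^N$: $\Phi(z_1,\ldots,z_N) \equiv 1 \pmod{p^l}$ if $f(\pi(z_1),\ldots,\pi(z_N))$ is a square in $\mathbb{F}_{q^i}^*$; $\Phi(z_1,\ldots,z_N) \equiv -1 \pmod{p^l}$ if $f(\pi(z_1),\ldots,\pi(z_N))$ is a non-square in $\mathbb{F}_{q^i}^*$; and $\Phi(z_1,\ldots,z_N) \equiv 0 \pmod{p^l}$ if $f(\pi(z_1),\ldots,\pi(z_N)) = 0$. *)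

(* Defs.v *)
From HB Require Import structures.
From mathcomp Require Import all_boot all_order all_algebra fraction.
From mathcomp Require Import boolp.
From mathcomp Require Import mpoly.

Set Implicit Arguments.
Unset Strict Implicit.
Unset Printing Implicit Defensive.

Import Order.TTheory GRing.Theory Num.Theory.
Local Open Scope ring_scope.

Lemma modz_dvdm (m d e : int) : (d %| e)%Z -> ((m %% e)%Z = m %[mod d])%Z.
Proof.
move=> /dvdzP[c ec]; rewrite [in RHS](divz_eq m e).
by move: (m %/ e)%Z (m %% e)%Z => u v; rewrite ec mulrA modzMDl.
Qed.

(* The inverse limit of the rings Z/p^n: an element is the sequence of its
   residues modulo p^n. The equation [pdigP] also forces 0 <= pdig n < p ^ n,
   so every p-adic integer has exactly one representation. The primality proof
   is a parameter so that the ring instances can be found from the type. *)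
Record padicInt (p : nat) (p_pr : prime p) := PadicInt {
  pdig : nat -> int;
  pdigP : forall n, pdig n = (pdig n.+1 %% (p ^ n)%N)%Z }.

Section PadicIntegers.

Variables (p : nat) (p_pr : prime p).

Local Notation padicInt := (padicInt p_pr).

HB.instance Definition _ := gen_eqMixin padicInt.
HB.instance Definition _ := gen_choiceMixin padicInt.

Lemma padicInt_ext (x y : padicInt) : (forall n, pdig x n = pdig y n) -> x = y.
Proof.
case: x y => [f fP] [g gP] /= /funext fg; case: _ / fg gP => gP.
by congr PadicInt; apply: Prop_irrelevance.
Qed.

Lemma padicInt_mod (x : padicInt) n : (pdig x n %% (p ^ n)%N)%Z = pdig x n.
Proof. by rewrite pdigP modz_mod. Qed.

Lemma pdigS (x : padicInt) n :
  (pdig x n.+1 = pdig x n %[mod (p ^ n)%N])%Z.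
Proof. by rewrite -pdigP padicInt_mod. Qed.

Definition coherent (f : nat -> int) :=
  forall n, (f n.+1 = f n %[mod (p ^ n)%N])%Z.

Lemma padic_mk_subproof (f : nat -> int) (fP : coherent f) n :
  (f n %% (p ^ n)%N)%Z = ((f n.+1 %% (p ^ n.+1)%N)%Z %% (p ^ n)%N)%Z.
Proof.
rewrite -(fP n); apply/esym/modz_dvdm.
by rewrite dvdzE /= expnS dvdn_mull.
Qed.

Definition padic_mk (f : nat -> int) (fP : coherent f) : padicInt :=
  @PadicInt p p_pr _ (padic_mk_subproof fP).

Lemma coherent_cst (m : int) : coherent (fun=> m).
Proof. by []. Qed.

Lemma coherent_opp (x : padicInt) : coherent (fun n => - pdig x n).
Proof. by move=> n; rewrite -modzNm pdigS modzNm. Qed.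

Lemma coherent_add (x y : padicInt) : coherent (fun n => pdig x n + pdig y n).
Proof. by move=> n; rewrite -modzDm !pdigS modzDm. Qed.

Lemma coherent_mul (x y : padicInt) : coherent (fun n => pdig x n * pdig y n).
Proof. by move=> n; rewrite -modzMm !pdigS modzMm. Qed.

Definition padic_zero := padic_mk (coherent_cst 0).
Definition padic_one := padic_mk (coherent_cst 1).
Definition padic_opp x := padic_mk (coherent_opp x).
Definition padic_add x y := padic_mk (coherent_add x y).
Definition padic_mul x y := padic_mk (coherent_mul x y).

Fact padic_addA : associative padic_add.
Proof.
by move=> x y z; apply: padicInt_ext => n /=; rewrite modzDml modzDmr addrA.
Qed.

Fact padic_addC : commutative padic_add.
Proof. by move=> x y; apply: padicInt_ext => n /=; rewrite addrC. Qed.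

Fact padic_add0 : left_id padic_zero padic_add.
Proof.
by move=> x; apply: padicInt_ext => n /=; rewrite modzDml add0r padicInt_mod.
Qed.

Fact padic_addN : left_inverse padic_zero padic_opp padic_add.
Proof.
by move=> x; apply: padicInt_ext => n /=; rewrite modzDml addNr.
Qed.

HB.instance Definition _ :=
  GRing.isZmodule.Build padicInt padic_addA padic_addC padic_add0 padic_addN.

Fact padic_mulA : associative padic_mul.
Proof.
by move=> x y z; apply: padicInt_ext => n /=; rewrite modzMml modzMmr mulrA.
Qed.

Fact padic_mulC : commutative padic_mul.
Proof. by move=> x y; apply: padicInt_ext => n /=; rewrite mulrC. Qed.

Fact padic_mul1 : left_id padic_one padic_mul.
Proof.
by move=> x; apply: padicInt_ext => n /=; rewrite modzMml mul1r padicInt_mod.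
Qed.

Fact padic_mulD : left_distributive padic_mul padic_add.
Proof.
by move=> x y z; apply: padicInt_ext => n /=; rewrite modzMml modzDm mulrDl.
Qed.

Fact padic_one_neq0 : padic_one != padic_zero.
Proof.
apply/eqP => /(congr1 (fun x => pdig x 1)) /=.
by rewrite expn1 mod0z modz_small // ltz_nat prime_gt1.
Qed.

HB.instance Definition _ := GRing.Zmodule_isComNzRing.Build padicInt
  padic_mulA padic_mulC padic_mul1 padic_mulD padic_one_neq0.

Definition padic_unit : pred padicInt := fun x => `[< exists y, y * x = 1 >].

Definition padic_inv (x : padicInt) : padicInt :=
  if pselect (exists y, y * x = 1) is left xU then projT1 (cid xU) else x.

Fact padic_mulV : {in padic_unit, left_inverse 1 padic_inv *%R}.
Proof.
move=> x /asboolP xU; rewrite /padic_inv.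
by case: pselect => // xU'; case: cid.
Qed.

Fact padic_unitP (x y : padicInt) : y * x = 1 -> x \in padic_unit.
Proof. by move=> yx1; apply/asboolP; exists y. Qed.

Fact padic_inv_out : {in [predC padic_unit], padic_inv =1 id}.
Proof.
move=> x /negP xNU; rewrite /padic_inv.
by case: pselect => // xU; case: xNU; apply/asboolP.
Qed.

HB.instance Definition _ := GRing.ComNzRing_hasMulInverse.Build padicInt
  padic_mulV padic_unitP padic_inv_out.

Lemma pdig_mod (x : padicInt) m k :
  pdig x m = (pdig x (k + m)%N %% (p ^ m)%N)%Z.
Proof.
elim: k => [|k IHk]; first by rewrite padicInt_mod.
rewrite IHk pdigP modz_dvdm // dvdzE /= dvdn_exp2l //; exact: leq_addl.
Qed.

Lemma padic_neq0P (x : padicInt) : x != 0 ->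
  exists m, forall k, ~~ (((p ^ m)%N : int) %| pdig x (k + m)%N)%Z.
Proof.
move=> /eqP xN0.
have [m xm] : exists m, pdig x m <> 0.
  apply: contrapT => /forallNP x0; apply: xN0; apply: padicInt_ext => n.
  by rewrite (contrapT (x0 n)) /= mod0z.
by exists m => k; apply/negP => /dvdz_mod0P; rewrite -pdig_mod.
Qed.

Fact padic_integral : GRing.integral_domain_axiom padicInt.
Proof.
move=> x y xy0; apply/norP => -[/padic_neq0P [m xm] /padic_neq0P [k yk]].
have /(congr1 (fun z => pdig z (m + k)%N)) /= := xy0.
rewrite mod0z => /dvdz_mod0P; rewrite dvdzE abszM /=.
have := yk m; have := xm k; rewrite !dvdzE /= (addnC k).
set a := `|pdig x _|%N; set b := `|pdig y _|%N => pa pb.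
have a0 : (0 < a)%N by rewrite lt0n; apply: contra pa => /eqP->.
have b0 : (0 < b)%N by rewrite lt0n; apply: contra pb => /eqP->.
move: pa pb; rewrite !pfactor_dvdn ?muln_gt0 ?a0 // lognM // -!ltnNge.
by move=> la lb; rewrite leqNgt -addnS leq_add // ltnW.
Qed.

HB.instance Definition _ :=
  GRing.ComUnitRing_isIntegral.Build padicInt padic_integral.

Definition padic : fieldType := {fraction padicInt}.

End PadicIntegers.

Section UnramifiedIntegers.

Variables (p : nat) (p_pr : prime p).
Variables (Qpbar : closedFieldType) (iota : {rmorphism padic p_pr -> Qpbar}).

Definition is_algebraic_closure := forall x : Qpbar, algebraicOver iota x.

Definition padicInt_embed (x : padicInt p_pr) : Qpbar := iota (tofrac x).

HB.instance Definition _ := GRing.RMorphism.copy padicInt_embed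
  (iota \o (@tofrac (padicInt p_pr))).

(* Q_p(mu_n): the intersection of all subfields of Qpbar that contain Q_p and
   the n-th roots of unity. *)
Definition in_cyclotomic (n : nat) (x : Qpbar) : Prop :=
  forall S : {pred Qpbar}, divring_closed S ->
    (forall y, iota y \in S) -> (forall z, n.-unity_root z -> z \in S) ->
  x \in S.

(* For m a power of p, the elements of the ring of integers of Q_p(mu_(m-1)). *)
Definition unram_int (m : nat) : {pred Qpbar} :=
  fun x => `[< in_cyclotomic m.-1 x /\ integralOver padicInt_embed x >].

Fact unram_int_subring m : subring_closed (unram_int m).
Proof.
split.
- apply/asboolP; split=> [S [] //|]; exact: integral1.
- move=> x y /asboolP[xS xZ] /asboolP[yS yZ]; apply/asboolP; split.
    move=> S Sf Qp mu; have [_ SB _] := Sf.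
    by apply: SB; [apply: xS | apply: yS].
  exact: integral_sub.
move=> x y /asboolP[xS xZ] /asboolP[yS yZ]; apply/asboolP; split.
  move=> S Sf Qp mu; have [S1 _ Sdiv] := Sf.
  rewrite -[y]invrK -[y^-1]mul1r; apply: (Sdiv); first exact: xS.
  by apply: (Sdiv) => //; apply: yS.
exact: integral_mul.
Qed.

HB.instance Definition _ m :=
  GRing.isSubringClosed.Build Qpbar (unram_int m) (unram_int_subring m).

Definition unramInt (m : nat) : Type := {x : Qpbar | x \in unram_int m}.

HB.instance Definition _ m := SubChoice.on (unramInt m).
HB.instance Definition _ m := [SubChoice_isSubComNzRing of unramInt m by <:].

End UnramifiedIntegers.

(* [pi] is the quotient map of the local ring [R] by its maximal ideal. *)
Definition is_residue_map (R : comNzRingType) (k : fieldType)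
    (pi : {rmorphism R -> k}) : Prop :=
  (forall y, exists x, pi x = y) /\
  (forall x, pi x = 0 <-> ~ (exists y, x * y = 1)).

Section QuasiNorm.

Variables (R : comNzRingType) (N : nat).
Implicit Types g : {mpoly R[N]}.

Definition quasi_power (n : nat) g : {mpoly R[N]} :=
  g \mPo [tuple 'X_j ^+ n | j < N].

Definition quasi_norm (q i : nat) g : {mpoly R[N]} :=
  \prod_(j < i) quasi_power (q ^ j) g.

End QuasiNorm.

Definition binz (x : int) (k : nat) : rat :=
  (\prod_(j < k) (x%:~R - j%:R)) / k`!%:R.

Lemma binz_nat (n k : nat) : binz n k = 'C(n, k)%:R.
Proof.
have k0 : k`!%:R != 0 :> rat by rewrite pnatr_eq0 -lt0n fact_gt0.
apply: (mulIf k0); rewrite /binz divfK // -natrM bin_ffact.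
elim: k {k0} => [|k IHk]; first by rewrite big_ord0.
rewrite big_ord_recr IHk ffactnSr natrM /=.
have [nk|kn] := ltnP n k; first by rewrite ffact_small // !mul0r.
by rewrite natrB.
Qed.

Definition binom_mx (l : nat) (b : int) : 'M[rat]_l :=
  \matrix_(j, k) binz (b + (2 * j)%N%:Z) k.

Definition eulerian_coef (l : nat) (l_gt0 : (0 < l)%N) (b : int) (k : 'I_l) :
    rat :=
  invmx (binom_mx l b) (Ordinal l_gt0) k.

Section Eulerian.

Variables (p : nat) (p_pr : prime p).
Variables (Qpbar : closedFieldType) (iota : {rmorphism padic p_pr -> Qpbar}).

Definition congr_mod_pow (m l : nat) (x y : unramInt iota m) : Prop :=
  exists t : unramInt iota m, x - y = (p ^ l)%:R * t.

(* [k] is indexed from 0. As the exponent is nonnegative when b > 0 and q is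
   odd, the absolute value only serves to cast it to nat. *)
Definition eulerian_poly (N l q i : nat) (l_gt0 : (0 < l)%N) (b : int)
    (F : {mpoly (unramInt iota q)[N]}) : {mpoly Qpbar[N]} :=
  \sum_(k < l) ratr (eulerian_coef l_gt0 b k) *:
    map_mpoly val (quasi_norm q i
      (F ^+ `|((b + (2 * k)%N%:Z) * (q%:Z - 1) %/ 2)%Z|%N)).

(* [Phi] is a function on mu_(q^i-1)^N; that it takes its values in Z_q is part
   of the definition. [j] is the inclusion of F_q in F_(q^i) and [pi] is the
   residue map of Z_(q^i). *)
Definition is_eulerian (N q i l : nat) (Fq Fqi : finFieldType)
    (j : {rmorphism Fq -> Fqi}) (pi : {rmorphism unramInt iota (q ^ i) -> Fqi})
    (f : {mpoly Fq[N]}) (Phi : ('I_N -> Qpbar) -> Qpbar) : Prop :=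
  forall z : 'I_N -> unramInt iota (q ^ i),
    (forall k, (q ^ i).-1.-unity_root (z k)) ->
  let v : Fqi := (map_mpoly j f).@[fun k => pi (z k)] in
  exists s : unramInt iota q,
    [/\ Phi (fun k => val (z k)) = val s,
        v != 0 -> (exists y, v = y ^+ 2) -> congr_mod_pow l s 1,
        v != 0 -> ~ (exists y, v = y ^+ 2) -> congr_mod_pow l s (-1)
      & v = 0 -> congr_mod_pow l s 0].

End Eulerian.

(* Main.v *)
Require Import Defs.
From HB Require Import structures.
From mathcomp Require Import fingroup perm.
From mathcomp Require Import generic_quotient cyclic separable cyclotomic
  finfield ring.
From mathcomp Require Import all_boot all_order all_algebra fraction.
From mathcomp Require Import boolp.
From mathcomp Require Import mpoly.

(* Let Q = p^d and let zeta be a root of unity of order Q - 1. Reduction is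
   injective on roots of unity, so the residue theta of zeta also has order
   Q - 1, and prod_(k<d) (X - theta^(p^k)) has coefficients in F_p. If A is an
   integer matrix whose characteristic polynomial lifts it, then A^(Q^n)
   converges p-adically to a matrix C with C^Q = C, whose eigenvalues are roots
   of unity with residues theta^(p^k). Hence prod_(k<d) (X - zeta^(p^k)) is the
   characteristic polynomial of C and lies in Z_p[X]. There are two consequences.
   - An element of Z_Q is g(zeta) / p^k with g over Z_p of degree < d. If g(zeta)
     reduces to 0, then the reduction of g has d conjugate roots, so p divides g;
     hence the kernel of the residue map of Z_Q is generated by p.
   - For Q = q^i and e = (q^i - 1) / (q - 1), the common roots of the polynomial
     above and of X^e - zeta^e are the zeta^(q^k), k < i. A symmetric function of
     them lies in every subfield that contains Q_p and the (q-1)-th roots of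
     unity, and so does the value a of the quasi norm of F at (zeta^(a_k))_k.
   Therefore a is in Z_q, and its residue is the norm of v = f(pi(z)). If v = 0,
   then p^l divides all powers of a that occur. Otherwise Euler's criterion gives
   a^((q-1)/2) = eps (1 + p y) with eps = 1 or -1 according to whether v is a
   square. The coefficients A_k satisfy sum_k A_k binom(b + 2 k, m) = 0 for
   0 < m < l and = 1 for m = 0, and are integers up to a power of 2, so
   sum_k A_k (1 + p y)^(b + 2 k) = 1 modulo p^l. *)

Import Order.TTheory GRing.Theory Num.Theory.
Local Open Scope ring_scope.

(** * p-adic integers *)

Section PadicDigits.

Variables (p : nat) (p_pr : prime p).
Local Notation Zp := (padicInt p_pr).

Lemma pdig_int (m : int) n : pdig (m%:~R : Zp) n = (m %% (p ^ n)%N)%Z.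
Proof.
suff -> : m%:~R = padic_mk p_pr (coherent_cst p m) by [].
elim: m => [|m IHm|m IHm]; first exact: padicInt_ext.
  by rewrite -addn1 PoszD intrD IHm; apply: padicInt_ext => k /=;
    rewrite modzDm.
rewrite -addn1 PoszD opprD intrD IHm intrN.
by apply: padicInt_ext => k /=; rewrite modzNm modzDm.
Qed.

(** Once the residue modulo p^n vanishes, p^n divides all later residues. Dividing by p^n costs n
    digits of precision, so the quotient is built from the sequence shifted by n. *)
Lemma padic_dvdP (x : Zp) n : pdig x n = 0 -> exists y, x = (p ^ n)%:R * y.
Proof.
move=> xn0.
have pn0 k : ((p ^ k)%N : int) != 0 by rewrite eqz_nat -lt0n expn_gt0 prime_gt0.
have dvdx k : (((p ^ n)%N : int) %| pdig x (k + n))%Z.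
  by apply/dvdz_mod0P; rewrite -pdig_mod.
have coh : coherent p (fun k => (pdig x (k + n) %/ (p ^ n)%N)%Z).
  move=> k; apply/eqP; rewrite eqz_mod_dvd -(@dvdz_mul2r (p ^ n)%N).
    rewrite mulrBl !divzK ?dvdx // -PoszM -expnD -eqz_mod_dvd.
    by apply/eqP; exact: pdigS.
  exact: pn0.
exists (padic_mk p_pr coh); apply: padicInt_ext => k.
rewrite -[_%:R]/(((p ^ n)%N : int)%:~R) /= pdig_int modzMml modzMmr mulrC.
by rewrite divzK ?dvdx // addnC -pdig_mod.
Qed.

Lemma pdig_mulX n (y : Zp) : pdig ((p ^ n)%:R * y) n = 0.
Proof.
rewrite -[_%:R]/(((p ^ n)%N : int)%:~R) /= pdig_int modzz mul0r.
by rewrite mod0z.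
Qed.

Lemma padic_approx (x : Zp) n :
  exists y, x = (pdig x n)%:~R + (p ^ n)%:R * y.
Proof.
have [|y xy] := @padic_dvdP (x - (pdig x n)%:~R) n.
  by rewrite /= pdig_int modzDmr padicInt_mod subrr mod0z.
by exists y; rewrite -xy addrC subrK.
Qed.

(** Bezout inverts each residue modulo p^n, and uniqueness of inverses makes the independent choices
    coherent. *)
Lemma padic_invertible (x : Zp) : pdig x 1 != 0 -> exists y, y * x = 1.
Proof.
move=> x1.
have inv n : exists y, (y * pdig x n = 1 %[mod (p ^ n)%N])%Z.
  case: n => [|n]; first by exists 0; rewrite !modz1.
  have : coprimez (pdig x n.+1) (p ^ n.+1)%N.
    rewrite coprimez_sym coprimezE /= coprimeXl // prime_coprime //.
    apply: contra x1 => px; rewrite (pdig_mod _ 1 n) expn1 addn1.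
    by apply/eqP/dvdz_mod0P; rewrite dvdzE.
  by case/coprimezP=> -[u v] /= uv; exists u; rewrite -uv addrC modzMDl.
have [y yP] := choice inv.
have coh : coherent p y.
  move=> n; have yn1 : (y n.+1 * pdig x n = 1 %[mod (p ^ n)%N])%Z.
    rewrite -modzMmr -pdigS modzMmr -[LHS](@modz_dvdm _ _ (p ^ n.+1)%N) ?yP.
      by rewrite modz_dvdm // dvdzE /= expnS dvdn_mull.
    by rewrite dvdzE /= expnS dvdn_mull.
  rewrite -[y n.+1]mulr1 -modzMmr -(yP n) modzMmr mulrCA -modzMmr yn1 modzMmr.
  by rewrite mulr1.
exists (padic_mk p_pr coh); apply: padicInt_ext => n /=.
by rewrite modzMml yP.
Qed.

(** Induction on the index of a nonzero residue: either x is a unit, or x = p y and the index drops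
    by one for y. *)
Lemma padic_factor (x : Zp) : x != 0 ->
  exists k u v, v * u = 1 /\ x = (p ^ k)%:R * u.
Proof.
move=> /padic_neq0P[m /(_ 0%N)]; rewrite add0n => xm.
have {xm} : pdig x m != 0 by apply: contraNneq xm => ->; rewrite dvdz0.
elim: m x => [|m IHm] x; first by rewrite -padicInt_mod expn0 modz1.
have [x1 xm|x1 _] := eqVneq (pdig x 1) 0; last first.
  by have [v vx] := padic_invertible x x1; exists 0%N, x, v; rewrite mul1r.
have [y xy] := padic_dvdP x 1 x1; rewrite expn1 in xy.
have [|k [u [v [vu yu]]]] := IHm y.
  apply: contraNneq xm => /padic_dvdP[z yz].
  by rewrite xy yz mulrA -natrM -expnS pdig_mulX.
by exists k.+1, u, v; split=> //; rewrite xy yu mulrA -natrM expnS.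
Qed.

Lemma padic_natr_eq0 n : (n%:R == 0 :> Zp) = (n == 0)%N.
Proof.
(* Since n < p^n, the residue of n modulo p^n is n itself. *)
apply/eqP/eqP => [|-> //] /(congr1 (fun x => pdig x n)).
rewrite -[_%:R]/((n : int)%:~R) pdig_int /= mod0z modz_small => [[]//|].
by rewrite ltz_nat ltn_expl ?prime_gt1.
Qed.

Lemma padic_eq0 (x : Zp) : (forall n, exists y, x = (p ^ n)%:R * y) -> x = 0.
Proof.
move=> xP; apply: padicInt_ext => n; have [y ->] := xP n.
by rewrite pdig_mulX /= mod0z.
Qed.

End PadicDigits.

(** * Symmetric functions of the roots of a polynomial over a subfield *)

Section SubField.
Variables (L : fieldType) (S : divringClosed L).
Definition subfield_type : Type := {x : L | x \in S}.
HB.instance Definition _ := SubChoice.on subfield_type.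
HB.instance Definition _ := [SubChoice_isSubComUnitRing of subfield_type by <:].
HB.instance Definition _ := [SubComUnitRing_isSubIntegralDomain of subfield_type
  by <:].
HB.instance Definition _ := [SubIntegralDomain_isSubField of subfield_type by
  <:].
End SubField.

(** [in_cyclotomic] quantifies over predicates, whereas gcds and symmetric functions need
    polynomials over a field type; this passes from one to the other. *)
Lemma subfield_of_pred (L : fieldType) (S : {pred L}) : divring_closed S ->
  exists (K : fieldType) (f : {rmorphism K -> L}),
    (forall x, x \in S -> exists y, x = f y) /\ (forall y, f y \in S).
Proof.
move=> Sf.
pose SM := GRing.isDivringClosed.Build L S Sf.
pose SC : divringClosed L := HB.pack S SM.
exists (subfield_type L SC), (val : {rmorphism subfield_type L SC -> L}).
by split=> [x xS|y]; [exists (exist _ x xS) | apply: valP].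
Qed.

Lemma meval_map (R S : comNzRingType) (f : {rmorphism R -> S}) n
    (v : 'I_n -> R) (g : {mpoly R[n]}) :
  (map_mpoly f g).@[fun k => f (v k)] = f g.@[v].
Proof.
rewrite {1}(mpolyE g) (raddf_sum (map_mpoly f)) (raddf_sum (meval _)) mevalE.
rewrite raddf_sum; apply: eq_bigr => m _ /=.
rewrite map_mpolyZ map_mpolyX mevalZ mevalX rmorphM rmorph_prod.
by congr (_ * _); apply: eq_bigr => k _; rewrite rmorphXn.
Qed.

(** The fundamental theorem writes g in terms of the elementary symmetric functions, whose values at
    the roots are the coefficients of h up to sign. *)
Lemma symmetric_roots_image (K L : fieldType) (f : {rmorphism K -> L}) n
    (ws : n.-tuple L) (h : {poly K}) (g : {mpoly K[n]}) :
  map_poly f h = \prod_(w <- ws) ('X - w%:P) -> g \is symmetric ->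
  exists y, (map_mpoly f g).@[tnth ws] = f y.
Proof.
move=> hws /sym_fundamental[t [<- _]].
pose e (k : 'I_n) : K := (-1) ^+ k.+1 * h`_(n - k.+1).
exists t.@[e]; rewrite -meval_map.
rewrite map_mpoly_comp; last exact: fmorph_inj.
rewrite comp_mpoly_meval; apply: meval_eq => k.
rewrite tnth_map tnth_mktuple.
have -> : map_mpoly f (mesym n K k.+1) = mesym n L k.+1.
  by apply/mpolyP => m; rewrite mcoeff_map_mpoly !mcoeff_mesym /= rmorph_nat.
have klt : (k.+1 < n.+1)%N by rewrite ltnS.
have /= := mroots_coeff ws (Ordinal klt).
rewrite -hws coef_map /= /e rmorphM rmorph_sign /= => ->.
by rewrite mulrA -exprD addnn -signr_odd odd_double mul1r.
Qed.

Lemma adjoin_divring (K L : fieldType) (f : {rmorphism K -> L}) (z : L) :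
  algebraicOver f z ->
  divring_closed [pred x | `[< exists g, x = (map_poly f g).[z] >]].
Proof.
move=> [h h0 hz]; split=> [|x y|x y] /=.
- by apply/asboolP; exists 1; rewrite rmorph1 hornerC.
- move=> /asboolP[g ->] /asboolP[k ->]; apply/asboolP; exists (g - k).
  by rewrite rmorphB hornerD hornerN.
move=> /asboolP[g ->] /asboolP[k ->]; apply/asboolP.
have [kz|kz] := eqVneq (map_poly f k).[z] 0.
  by exists 0; rewrite kz invr0 mulr0 rmorph0 horner0.
have k0 : k != 0 by apply: contraNneq kz => ->; rewrite rmorph0 horner0.
(* As h may be reducible, it is first freed of its common factors with k. What is left still
   vanishes at z, because k does not, and Bezout inverts k(z). *)
have : coprimep (gdcop k h) k by rewrite coprimep_gdco.
move=> /Bezout_eq1_coprimepP[[u v] /= uv1].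
exists (g * v); rewrite rmorphM hornerM; congr (_ * _).
apply: (mulIf kz); rewrite mulVf // -hornerM -rmorphM /=.
have /(congr1 (fun r => (map_poly f r).[z])) := uv1.
rewrite rmorphD rmorph1 hornerD hornerC (rmorphM _ u) hornerM /=.
suff /rootP-> : root (map_poly f (gdcop k h)) z by rewrite mulr0 add0r.
by rewrite gdcop_map root_gdco ?map_poly_eq0 // hz.
Qed.

(** A gcd over K remains a gcd over L, and the roots of h are simple, so the monic multiple of the
    gcd of h and t is the product sought. *)
Lemma common_roots_image (K L : fieldType) (f : {rmorphism K -> L})
    (h t : {poly K}) (ws : seq L) :
    uniq ws -> map_poly f h = \prod_(w <- ws) ('X - w%:P) ->
  exists g, map_poly f g = \prod_(w <- ws | root (map_poly f t) w) ('X - w%:P).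
Proof.
move=> uws hws; pose G := gcdp h t; rewrite -big_filter.
set P := bigop _ _ _.
have PG : P %= map_poly f G.
  rewrite gcdp_map; apply/andP; split.
    apply: uniq_roots_dvdp; last by rewrite uniq_rootsE filter_uniq.
    apply/allP => w; rewrite mem_filter root_gcd hws root_prod_XsubC.
    by rewrite andbC.
  have := dvdp_gcdl (map_poly f h) (map_poly f t); rewrite {2}hws.
  case/dvdp_prod_XsubC => m Gm; rewrite (eqp_dvdl _ Gm).
  apply: uniq_roots_dvdp; last by rewrite uniq_rootsE mask_uniq.
  apply/allP => w wm; have := wm.
  rewrite -(root_prod_XsubC (mask m ws)) -(eqp_root Gm) root_gcd => /andP[_ wt].
  by rewrite root_prod_XsubC mem_filter wt (mem_mask wm).
have [c c0 cG] : exists2 c, c != 0 & P = c *: map_poly f G.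
  have /eqpP[[a b] /= /andP[a0 b0] ab] := PG.
  exists (a^-1 * b); first by rewrite mulf_neq0 ?invr_eq0.
  by rewrite -scalerA -ab scalerA mulVf ?scale1r.
have G0 : G != 0.
  by rewrite -(map_poly_eq0 f); apply: contraTneq PG => ->;
    rewrite eqp0 monic_neq0 ?monic_prod_XsubC.
exists ((lead_coef G)^-1 *: G); rewrite -mul_polyC rmorphM /= map_polyC
  mul_polyC.
rewrite cG; congr (_ *: _).
have := monic_prod_XsubC [seq w <- ws | root (map_poly f t) w] xpredT id.
rewrite monicE -/P cG lead_coefZ lead_coef_map => /eqP cl.
by rewrite -[RHS]mulr1 -(mulfV (_ : f (lead_coef G) != 0)) ?fmorph_eq0
  ?lead_coef_eq0 //
  mulrA cl mul1r /= fmorphV.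
Qed.

(** * Teichmueller lifts of integer matrices *)

Section Congruence.
Variable R : nzRingType.
Implicit Types (A B C : R) (m : nat).

Definition congr_nat m A B := exists C, A = B + m%:R * C.

Lemma congr_nat_refl m A : congr_nat m A A.
Proof. by exists 0; rewrite mulr0 addr0. Qed.

Lemma congr_nat_trans m A B C :
  congr_nat m A B -> congr_nat m B C -> congr_nat m A C.
Proof. by move=> [D ->] [E ->]; exists (E + D); rewrite mulrDr addrA. Qed.

Lemma congr_nat_sym m A B : congr_nat m A B -> congr_nat m B A.
Proof. by move=> [D ->]; exists (- D); rewrite mulrN addrK. Qed.

Lemma congr_natD m A A' B B' :
  congr_nat m A A' -> congr_nat m B B' -> congr_nat m (A + B) (A' + B').
Proof. by move=> [D ->] [E ->]; exists (D + E); rewrite mulrDr addrACA. Qed.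

Lemma congr_natM m A A' B B' :
  congr_nat m A A' -> congr_nat m B B' -> congr_nat m (A * B) (A' * B').
Proof.
move=> [D ->] [E ->]; exists (A' * E + D * (B' + m%:R * E)).
rewrite mulrDl (mulrDr A') -addrA (mulrDr m%:R) [m%:R * (D * _)]mulrA.
by congr (_ + (_ + _)); rewrite !mulr_natl mulrnAr.
Qed.

Lemma congr_natX m A B k : congr_nat m A B -> congr_nat m (A ^+ k) (B ^+ k).
Proof.
move=> AB; elim: k => [|k IHk]; first exact: congr_nat_refl.
by rewrite !exprS; apply: congr_natM.
Qed.

Lemma congr_nat_dvd m n A B : (n %| m)%N -> congr_nat m A B -> congr_nat n A B.
Proof.
by move=> /dvdnP[k ->] [D ->]; exists (k%:R * D); rewrite mulrA -natrM mulnC.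
Qed.

(** A^p - B^p is A - B times the sum of the p terms A^(p-1-i) B^i. Each term is B^(p-1) modulo p, so
    the sum contributes one more factor p. *)
Lemma congr_nat_exp p k A B : GRing.comm A B ->
  congr_nat (p ^ k.+1) A B -> congr_nat (p ^ k.+2) (A ^+ p) (B ^+ p).
Proof.
move=> cAB AB; have [C S_C] : congr_nat p
    (\sum_(i < p) A ^+ (p.-1 - i) * B ^+ i) (\sum_(i < p) B ^+ p.-1).
  elim/big_ind2: _ => [|A1 B1 A2 B2|[i ip] _ /=]; first exact: congr_nat_refl.
    by move=> ? ?; apply: congr_natD.
  have -> : B ^+ p.-1 = B ^+ (p.-1 - i) * B ^+ i.
    by rewrite -exprD subnK // -ltnS prednK // (leq_ltn_trans _ ip).
  apply: congr_natM; last exact: congr_nat_refl.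
  by apply/congr_natX/congr_nat_dvd/AB; rewrite expnS dvdn_mulr.
have [D DE] := AB.
exists (D * (B ^+ p.-1 + C)); rewrite -[LHS](addrNK (B ^+ p)) addrC;
  congr (_ + _).
rewrite subrXX_comm // [X in X - _]DE addrC addKr.
rewrite (eq_bigr (fun i : 'I_p => A ^+ (p.-1 - i) * B ^+ i)); last first.
  by move=> i _; rewrite -subn1 -subnDA add1n.
rewrite S_C sumr_const card_ord -[_ *+ p]mulr_natl -mulrDr.
by rewrite [(p ^ k.+2)%N]expnSr natrM -!mulrA; congr (_ * _);
  rewrite !mulr_natl mulrnAr.
Qed.

Lemma congr_nat_exp_iter p k d A B : GRing.comm A B ->
  congr_nat (p ^ k.+1) A B -> congr_nat (p ^ (k + d).+1) (A ^+ (p ^ d)) (B ^+ (p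
    ^ d)).
Proof.
move=> cAB AB; elim: d => [|d IHd]; first by rewrite addn0 !expr1.
rewrite !(expnSr p d) !exprM addnS; apply: congr_nat_exp => //.
by apply/commrX/commr_sym/commrX/commr_sym.
Qed.

End Congruence.

Lemma congr_nat_rmorph (R S : nzRingType) (f : {rmorphism R -> S}) m (A B : R) :
  congr_nat R m A B -> congr_nat S m (f A) (f B).
Proof. by move=> [C ->]; exists (f C); rewrite rmorphD rmorphM rmorph_nat. Qed.

Lemma natr_mulmxE (R : nzRingType) n m (A : 'M[R]_n.+1) i j :
  (m%:R * A) i j = m%:R * A i j.
Proof. by rewrite !mulr_natl mulmxnE. Qed.

Section TeichmullerMatrix.

Variables (p : nat) (p_pr : prime p) (d n : nat).
Hypothesis d_gt0 : (0 < d)%N.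
Local Notation Zp := (padicInt p_pr).
Local Notation Q := (p ^ d)%N.

(** Raising a congruence to the power Q = p^d gains d factors p, of which one per step is kept. *)
Lemma congr_nat_iter (A : 'M[int]_n.+1) k :
  congr_nat _ p (A ^+ Q) A -> congr_nat _ (p ^ k.+1) (A ^+ (Q ^ k.+1)) (A ^+ (Q
    ^ k)).
Proof.
move=> AQ; elim: k => [|k IHk]; first by rewrite expn0 !expn1 expr1.
rewrite (expnSr Q k.+1) (exprM _ _ Q) {2}(expnSr Q k) (exprM _ _ Q).
apply: (congr_nat_dvd _ (p ^ (k + d).+1)).
  by rewrite dvdn_exp2l // ltnS -addn1 leq_add2l.
apply: congr_nat_exp_iter IHk.
exact/commrX/commr_sym/commrX.
Qed.

Lemma teichmuller_mx (A : 'M[int]_n.+1) : congr_nat _ p (A ^+ Q) A ->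
  exists C : 'M[Zp]_n.+1, C ^+ Q = C /\ congr_nat _ p C (map_mx intr A).
Proof.
move=> AQ; pose a k := A ^+ (Q ^ k).
have coh i j : coherent p (fun k => a k i j).
  move=> k; have [D DE] := congr_nat_iter A k AQ; apply/eqP.
  rewrite /a DE mxE natr_mulmxE expnS natrM -mulrA mulrCA.
  by rewrite addrC natz mulrC modzMDl.
pose C := \matrix_(i, j) padic_mk p_pr (coh i j).
have Ca k : congr_nat _ (p ^ k) C (map_mx intr (a k)).
  have /choice[D DE] : forall ij : 'I_n.+1 * 'I_n.+1,
      exists y, C ij.1 ij.2 = (a k ij.1 ij.2)%:~R + (p ^ k)%:R * y.
    move=> [i j] /=.
    have [|y yE] := padic_dvdP p p_pr (C i j - (a k i j)%:~R) k.
      by rewrite /= pdig_int !mxE /= modzDmr subrr mod0z.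
    by exists y; rewrite -yE addrC subrK.
  exists (\matrix_(i, j) D (i, j)); apply/matrixP => i j.
  by rewrite (DE (i, j)) [RHS]mxE natr_mulmxE !mxE.
exists C; split; last first.
  have := Ca 1%N; rewrite /a !expn1 => CA.
  by apply: congr_nat_trans CA _; apply: congr_nat_rmorph.
(* Modulo p^k the chain C^Q = (a k)^Q = a (k+1) = a k = C holds, for every k. *)
apply/eqP; rewrite -subr_eq0; apply/eqP/matrixP => i j.
rewrite [RHS]mxE; apply: padic_eq0 => k.
have [D DE] : congr_nat _ (p ^ k) (C ^+ Q) C.
  apply: (congr_nat_trans _ _ _ (map_mx intr (a k) ^+ Q)).
    by apply: congr_natX; apply: Ca.
  apply: (congr_nat_trans _ _ _ (map_mx intr (a k)));
    last by apply: congr_nat_sym; apply: Ca.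
  pose f : {rmorphism 'M[int]_n.+1 -> 'M[Zp]_n.+1} := map_mx intr.
  rewrite -[map_mx intr (a k)]/(f (a k)) -rmorphXn /a -exprM -expnSr.
  apply: congr_nat_rmorph; apply: congr_nat_dvd (congr_nat_iter A k AQ).
  by rewrite expnS dvdn_mull.
exists (D i j).
by rewrite DE [C + _]addrC addrK natr_mulmxE.
Qed.

End TeichmullerMatrix.

(** * Roots of unity and their residues *)

(** As n is invertible, X^n - 1 is separable and has n distinct roots; they form a cyclic group. *)
Lemma closed_prim_root_exists (L : closedFieldType) n : n%:R != 0 :> L ->
  exists z : L, n.-primitive_root z.
Proof.
move=> n0; have n_gt0 : (0 < n)%N by case: n n0 => //; rewrite eqxx.
have [r Dp] := closed_field_poly_normal ('X^n - 1 : {poly L}).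
rewrite (monicP _) ?monicXnsubC // scale1r in Dp.
have rn1: all n.-unity_root r by apply/allP=> z; rewrite -root_prod_XsubC -Dp.
have sz_r: (n < (size r).+1)%N.
  by rewrite -(size_prod_XsubC r id) -Dp size_XnsubC.
have [|z] := hasP (has_prim_root n_gt0 rn1 _ sz_r); last by exists z.
by rewrite -separable_prod_XsubC -Dp separable_Xn_sub_1.
Qed.

(** Divide the factored form of X^n - 1 by X - 1 and evaluate at 1. *)
Lemma prod_1_sub_prim_root (L : fieldType) n (z : L) : n.-primitive_root z ->
  \prod_(1 <= k < n) (1 - z ^+ k) = n%:R.
Proof.
move=> prz; have n_gt0 := prim_order_gt0 prz.
have := factor_Xn_sub_1 prz; rewrite big_ltn // expr0 subrX1.
move=> /(mulfI (negbT (polyXsubC_eq0 _))) /(congr1 (fun r => r.[1])).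
rewrite horner_prod horner_sum => e.
rewrite -[RHS](_ : \sum_(k < n) (1 : L) = _); last by rewrite sumr_const
  card_ord.
rewrite -[RHS](_ : \sum_(k < n) ('X^k).[1] = _); last first.
  by apply: eq_bigr => k _; rewrite hornerXn expr1n.
by rewrite -e; apply: eq_bigr => k _; rewrite hornerXsubC.
Qed.

Lemma fraction_numden (R : idomainType) (y : {fraction R}) :
  exists a b, b != 0 /\ y * tofrac b = tofrac a.
Proof.
elim/quotW: y => x; exists x.1, x.2; split; first exact: denom_ratioP.
rewrite -[_ * _]/(FracField.mul _ _) !piE; apply/eqmodP.
rewrite /= FracField.equivfE /FracField.mulf.
rewrite !numden_Ratio ?mulf_neq0 ?oner_eq0 ?denom_ratioP //.
by rewrite !mulr1 mulrC.
Qed.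

(** * The p-adic integers inside the rings of integers *)

Section UnramifiedIntegersBasics.

Variables (p : nat) (p_pr : prime p).
Variables (Qpbar : closedFieldType) (iota : {rmorphism padic p_pr -> Qpbar}).
Local Notation Zp := (padicInt p_pr).
Local Notation emb := (padicInt_embed iota).

Lemma padicInt_embed_inj : injective emb.
Proof. by move=> x y /fmorph_inj/eqP; rewrite tofrac_eq => /eqP. Qed.

Lemma natr_Qpbar_eq0 n : (n%:R == 0 :> Qpbar) = (n == 0)%N.
Proof.
by rewrite -(padic_natr_eq0 p p_pr) -(inj_eq padicInt_embed_inj) rmorph_nat
  rmorph0.
Qed.

Lemma padic_scale (y : padic p_pr) :
  exists k a, (p ^ k)%:R * y = tofrac a :> padic p_pr.
Proof.
have [a [b [b0 yb]]] := fraction_numden _ y.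
have [k [u [v [vu bE]]]] := padic_factor p p_pr b b0.
exists k, (a * v); rewrite rmorphM /= -yb bE rmorphM rmorph_nat -!mulrA.
by rewrite -rmorphM (mulrC u) vu rmorph1 mulr1 mulrC.
Qed.

Lemma unram_unity m (z : Qpbar) :
  (0 < m.-1)%N -> m.-1.-unity_root z -> z \in unram_int iota m.
Proof.
move=> m_gt0 zm; apply/asboolP; split; first by move=> S _ _; apply.
exists ('X^(m.-1) - 1); first by rewrite monicXnsubC.
by rewrite rmorphB rmorph1 /= map_polyXn.
Qed.

Lemma unram_embed m (x : Zp) : emb x \in unram_int iota m.
Proof.
apply/asboolP; split; first by move=> S _ Qp _; apply: Qp.
exact: integral_id.
Qed.

Definition unram_of_padic m (x : Zp) : unramInt iota m :=
  exist _ (emb x) (unram_embed m x).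

Fact unram_of_padic_zmod m : zmod_morphism (unram_of_padic m).
Proof. by move=> x y; apply: val_inj; rewrite /= rmorphB. Qed.

Fact unram_of_padic_monoid m : monoid_morphism (unram_of_padic m).
Proof.
by split=> [|x y]; apply: val_inj; rewrite /= (rmorph1, rmorphM).
Qed.

HB.instance Definition _ m :=
  GRing.isZmodMorphism.Build Zp (unramInt iota m) (unram_of_padic m)
    (unram_of_padic_zmod m).
HB.instance Definition _ m :=
  GRing.isMonoidMorphism.Build Zp (unramInt iota m) (unram_of_padic m)
    (unram_of_padic_monoid m).

End UnramifiedIntegersBasics.

(** For p > 2 the exponents p^k with k < d are all smaller than the order p^d - 1 of w. *)
Lemma frobenius_orbit_inj (L : fieldType) p d (w : L) :
    (2 < p)%N -> (p ^ d).-1.-primitive_root w ->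
  {in iota 0 d &, injective (fun k => w ^+ (p ^ k))}.
Proof.
move=> p_gt2 prw a b; rewrite !mem_iota !add0n /= => ad bd.
have p_gt1 := ltn_trans (ltnSn 1) p_gt2.
have lt_pow c : (c < d)%N -> (p ^ c < (p ^ d).-1)%N.
  case: d {prw ad bd} => // d cd.
  have p0 : (0 < p ^ d)%N by rewrite expn_gt0 (ltn_trans _ p_gt1).
  rewrite (@leq_ltn_trans (p ^ d)) ?leq_pexp2l ?(ltn_trans _ p_gt1) //.
  rewrite expnS -ltnS prednK ?muln_gt0 ?p0 ?(ltn_trans _ p_gt1) //.
  rewrite (@leq_ltn_trans (2 * p ^ d)) ?ltn_pmul2r // mul2n -addnn -addn1.
  by rewrite leq_add2l.
move=> /eqP; rewrite (eq_prim_root_expr prw) !modn_small ?lt_pow //.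
by rewrite eqn_exp2l // => /eqP.
Qed.

Lemma uniq_frobenius_orbit (L : fieldType) p d (w : L) :
  (2 < p)%N -> (p ^ d).-1.-primitive_root w ->
  uniq [seq w ^+ (p ^ k) | k <- iota 0 d].
Proof.
by move=> p_gt2 prw; rewrite map_inj_in_uniq ?iota_uniq //;
  apply: frobenius_orbit_inj.
Qed.

(** The p elements of the prime field are already roots of X^p - X, and a further root would exceed
    the degree. *)
Lemma frobenius_fixed_natr (L : fieldType) p (c : L) : p \in [pchar L] ->
  c ^+ p = c -> exists m : nat, c = m%:R.
Proof.
move=> chp cp; have p_pr := pcharf_prime chp.
have [m cm|nc] := pickP (fun m : 'I_p => c == m%:R).
  by exists m; apply/eqP.
pose rs := c :: [seq m%:R : L | m <- iota 0 p].
pose P : {poly L} := 'X^p - 'X; suff : (size rs < size P)%N.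
  rewrite size_polyDl ?size_polyXn ?size_polyN ?size_polyX ?ltnS ?prime_gt1 //=.
  by rewrite size_map size_iota ltnn.
apply: max_poly_roots.
- rewrite -size_poly_gt0 size_polyDl ?size_polyXn //.
  by rewrite size_polyN size_polyX ltnS prime_gt1.
- apply/allP => x; rewrite inE rootE !hornerE subr_eq0.
  case/predU1P => [->|/mapP[m _ ->]]; first by rewrite cp.
  by rewrite -(pFrobenius_autE chp) rmorph_nat.
rewrite /= map_inj_in_uniq ?iota_uniq ?andbT.
  by apply/mapP => -[m]; rewrite mem_iota => /= mp cm; have := nc (Ordinal mp);
    rewrite cm eqxx.
have wl a b : (a <= b)%N -> (b < p)%N -> a%:R = b%:R :> L -> a = b.
  move=> ab bp e; apply/eqP; rewrite eqn_leq ab /= -subn_eq0.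
  have : (p %| b - a)%N by rewrite (dvdn_pcharf chp) natrB // e subrr.
  by rewrite /dvdn modn_small // (leq_ltn_trans _ bp) ?leq_subr.
move=> a b; rewrite !mem_iota !add0n /= => ap bp e.
by have [ab|/ltnW ba] := leqP a b; [apply: wl|apply/esym/wl].
Qed.

(** The product is invariant under Frobenius, so its coefficients lie in the prime field and lift to
    integers; A is the companion matrix of the lift. The size is written as a successor because only
    then do square matrices form a nonzero ring. *)
Lemma companion_lift (F : finFieldType) p d (w : F) :
    (2 < p)%N -> #|F| = (p ^ d)%N -> p \in [pchar F] -> (0 < d)%N ->
    (p ^ d).-1.-primitive_root w ->
  exists d' (A : 'M[int]_d'.+1), d'.+1 = d /\
    char_poly (map_mx intr A : 'M[F]_d'.+1) =
      \prod_(u <- [seq w ^+ (p ^ k) | k <- iota 0 d]) ('X - u%:P).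
Proof.
move=> p_gt2 cardF chp d_gt0 prw; set P := bigop _ _ _.
(* Frobenius moves each factor to the next one, and the last to the first because w^(p^d) = w. *)
have Pfix : map_poly (pFrobenius_aut chp) P = P.
  rewrite rmorph_prod /P !big_map.
  case: d d_gt0 cardF prw @P => // d _ cardF prw P.
  have iotaS : iota 0 d.+1 = rcons (iota 0 d) d by rewrite -addn1 iotaD cats1.
  rewrite [in LHS]iotaS big_rcons /= [RHS]big_cons mulrC (iotaDl 1 0) big_map.
  congr (_ * _).
    rewrite rmorphB /= map_polyX map_polyC /= pFrobenius_autE -exprM -expnSr.
    by rewrite -cardF expf_card expn0 expr1.
  apply: eq_bigr => k _.
  by rewrite rmorphB /= map_polyX map_polyC /= pFrobenius_autE -exprM -expnSr
    add1n.
have sP : size P = d.+1 by rewrite size_prod_XsubC size_map size_iota.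
have mP : P \is monic by apply: monic_prod_XsubC.
have /choice[m mE] (k : nat) : exists m : nat, P`_k = m%:R.
  apply: (frobenius_fixed_natr _ _ _ chp).
  by rewrite -[in RHS]Pfix coef_map /= pFrobenius_autE.
pose H : {poly int} := 'X^d + \poly_(k < d) (m k)%:R.
have sH : size H = d.+1.
  by rewrite size_polyDl size_polyXn // ltnS size_poly.
have mH : H \is monic.
  by rewrite monicE lead_coefDl ?lead_coefXn // size_polyXn ltnS size_poly.
have HP : map_poly intr H = P.
  apply/polyP => k; rewrite coef_map coefD coefXn coef_poly.
  have [->|kd] := eqVneq k d.
    rewrite ltnn addr0; have := mP; rewrite monicE lead_coefE sP /= => /eqP ->.
    by rewrite rmorph1.
  rewrite add0r; case: ltnP => kd'; first by rewrite /= natz mE.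
  by rewrite nth_default ?rmorph0 // sP ltn_neqAle eq_sym kd.
have [d' dE] : exists d', (size H).-1 = d'.+1 by exists d.-1; rewrite sH prednK.
move: (companionmx H) (companionmxK mH); rewrite dE => A AH.
exists d', A; split; first by rewrite -dE sH.
by rewrite -map_char_poly AH.
Qed.

(** * Reduction of roots of unity and of their Frobenius orbits *)

Section ResidueField.

Variables (p : nat) (p_pr : prime p) (p_gt2 : (2 < p)%N).
Variables (Qpbar : closedFieldType) (phi : {rmorphism padic p_pr -> Qpbar}).
Variables (d : nat) (d_gt0 : (0 < d)%N).
Local Notation Zp := (padicInt p_pr).
Local Notation emb := (padicInt_embed phi).
Local Notation Q := (p ^ d)%N.
Local Notation U := (unramInt phi Q).
Variables (F : finFieldType) (card_F : #|F| = Q) (pi : {rmorphism U -> F}).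

Lemma residue_pchar : p \in [pchar F].
Proof. exact: card_finPcharP card_F p_pr. Qed.

Lemma pred_card_gt1 : (1 < Q.-1)%N.
Proof.
rewrite -subn1 ltn_subRL (leq_trans p_gt2) //.
by rewrite -{1}[p]expn1 leq_exp2l ?(ltn_trans _ p_gt2).
Qed.

Lemma residue_pred_card : Q.-1%:R = -1 :> F.
Proof.
apply/eqP; rewrite -addr_eq0 -[1]/(1%:R) -natrD addn1 prednK ?expn_gt0
  ?prime_gt0 //.
by rewrite natrX (pcharf0 residue_pchar) expr0n eqn0Ngt d_gt0.
Qed.

(** If pi(z)^k = 1 with 0 < k < Q - 1, the product of the 1 - z^m reduces to 0. But this product is
    Q - 1, which is -1 in F. *)
Lemma residue_prim (z : U) :
  Q.-1.-primitive_root (val z) -> Q.-1.-primitive_root (pi z).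
Proof.
move=> prz; have n_gt0 : (0 < Q.-1)%N by rewrite ltnW // pred_card_gt1.
have zn : z ^+ Q.-1 = 1.
  by apply: val_inj; rewrite rmorphXn rmorph1; exact: prim_expr_order.
have pz k : (0 < k < Q.-1)%N -> pi z ^+ k != 1.
  move=> kn; apply/eqP => pzk.
  have : \prod_(1 <= m < Q.-1) (1 - z ^+ m) = Q.-1%:R.
    apply: val_inj; rewrite rmorph_prod rmorph_nat -(prod_1_sub_prim_root _ _ _
      prz).
    by apply: eq_bigr => m _; rewrite rmorphB rmorph1 rmorphXn.
  move=> /(congr1 pi); rewrite rmorph_nat residue_pred_card rmorph_prod.
  rewrite (bigD1_seq k) ?iota_uniq ?mem_index_iota //=.
  rewrite rmorphB rmorph1 rmorphXn pzk subrr mul0r => /esym/eqP.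
  by rewrite oppr_eq0 oner_eq0.
rewrite /primitive_root_of_unity n_gt0; apply/forallP => -[m /= mn].
rewrite unity_rootE; have [->|nm] := eqVneq m.+1 Q.-1.
  by rewrite -rmorphXn zn rmorph1 !eqxx.
by rewrite (negPf (pz _ _)) //= ltn_neqAle nm.
Qed.

Lemma frobenius_orbit_poly (z : U) : Q.-1.-primitive_root (val z) ->
  exists h : {poly Zp}, map_poly emb h =
    \prod_(u <- [seq val z ^+ (p ^ k) | k <- iota 0 d]) ('X - u%:P).
Proof.
move=> prz; have prw := residue_prim z prz.
have [d' [A [dE Ah]]] :=
  companion_lift F p d (pi z) p_gt2 card_F residue_pchar d_gt0 prw.
pose f : {rmorphism 'M[int]_d'.+1 -> 'M[F]_d'.+1} := map_mx intr.
(* Modulo p the characteristic polynomial of A has d distinct roots in F, so it divides X^Q - X, and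
   Cayley-Hamilton applies. *)
have AQ : congr_nat _ p (A ^+ Q) A.
  have fAQ : f A ^+ Q = f A.
    have /dvdpP[g gE] : char_poly (f A) %| 'X^Q - 'X.
      rewrite Ah; apply: uniq_roots_dvdp; last first.
        by rewrite uniq_rootsE uniq_frobenius_orbit.
      by apply/allP => x _; rewrite rootE !hornerE -card_F expf_card subrr.
    have /(congr1 (horner_mx (f A))) := gE.
    rewrite [RHS]rmorphM [X in _ = _ * X]Cayley_Hamilton mulr0 rmorphB rmorphXn
      /=.
    by rewrite horner_mx_X => /eqP; rewrite subr_eq0 => /eqP.
  have /choice[D DE] (ij : 'I_d'.+1 * 'I_d'.+1) :
      exists y, (A ^+ Q) ij.1 ij.2 = A ij.1 ij.2 + p%:R * y.
    have /dvdzP[y yE] : (p %| (A ^+ Q - A) ij.1 ij.2)%Z.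
      rewrite (dvdz_pcharf residue_pchar).
      have : f (A ^+ Q - A) ij.1 ij.2 = 0 by rewrite rmorphB rmorphXn fAQ subrr
        mxE.
      by rewrite [LHS]mxE => ->.
    by exists y; rewrite mulrC natz -yE mxE [X in _ + (_ + X)]mxE addrCA subrr
      addr0.
  exists (\matrix_(i, j) D (i, j)); apply/matrixP => i j.
  by rewrite (DE (i, j)) [RHS]mxE natr_mulmxE !mxE.
have [C [CQ CA]] := teichmuller_mx p p_pr d d' d_gt0 A AQ.
pose h := char_poly C; exists h.
pose rho : {rmorphism Zp -> F} := pi \o unram_of_padic p p_pr Qpbar phi Q.
have rhoh : map_poly rho h =
    \prod_(u <- [seq pi z ^+ (p ^ k) | k <- iota 0 d]) ('X - u%:P).
  rewrite /h map_char_poly -Ah; congr char_poly; apply/matrixP => i j.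
  have [D ->] := CA; rewrite [LHS]mxE [X in rho X]mxE [RHS]mxE natr_mulmxE.
  rewrite rmorphD rmorphM rmorph_nat mxE.
  by rewrite (pcharf0 residue_pchar) mul0r addr0 rmorph_int.
have eig l : root (map_poly emb h) l -> l ^+ Q = l.
  rewrite map_char_poly -eigenvalue_root_char => /eigenvalueP[v vC v0].
  pose CL : 'M_d'.+1 := map_mx emb C.
  have vCk k : v *m CL ^+ k = l ^+ k *: v.
    elim: k => [|k IHk]; first by rewrite mulmx1 scale1r.
    by rewrite exprSr -mulmxE mulmxA IHk -scalemxAl vC scalerA -exprSr.
  have CLQ : CL ^+ Q = CL.
    pose g : {rmorphism 'M[Zp]_d'.+1 -> 'M[Qpbar]_d'.+1} := map_mx emb.
    by rewrite -[CL]/(g C) -rmorphXn CQ.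
  have /eqP := vCk Q; rewrite CLQ vC -subr_eq0 -scalerBl scaler_eq0 (negPf v0).
  by rewrite orbF subr_eq0 => /eqP.
have [r hr] := closed_field_poly_normal (map_poly emb h).
have mh : map_poly emb h \is monic by rewrite monic_map ?char_poly_monic.
rewrite (monicP mh) scale1r in hr.
(* A nonzero l with l^Q = l is a (Q-1)-th root of unity. Thus the eigenvalues lie in [U] and can be
   reduced by [pi]. *)
have rU l : l \in r -> l \in unram_int phi Q.
  rewrite -root_prod_XsubC -hr => /eig lQ.
  have [->|l0] := eqVneq l 0; first exact: rpred0.
  apply: unram_unity; first by rewrite ltnW // pred_card_gt1.
  rewrite unity_rootE; apply/eqP/(mulfI l0).
  by rewrite -exprS prednK ?expn_gt0 ?prime_gt0 // lQ mulr1.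
have [s sr] : exists s : seq U, r = map val s.
  exists (pmap insub r); rewrite pmap_filter; last exact: insubK.
  by symmetry; apply/all_filterP/allP => l /rU lU; rewrite /= insubT.
have hs : map_poly (unram_of_padic p p_pr Qpbar phi Q) h =
  \prod_(u <- s) ('X - u%:P).
  pose v : {rmorphism U -> Qpbar} := val.
  apply: (map_inj_poly (val_inj : injective v) (rmorph0 _)).
  rewrite -map_poly_comp map_prod_XsubC -(big_map v xpredT (fun l =>
    'X - l%:P)); transitivity (map_poly emb h) => //.
  by rewrite hr sr.
(* Some root u of h has residue pi(z)^(p^k). It is nonzero, hence a power of z; as z and pi(z) have
   the same order, u = z^(p^k). *)
have mem_roots k : (k < d)%N -> root (map_poly emb h) (val z ^+ (p ^ k)).
  move=> kd; have : root (map_poly rho h) (pi z ^+ (p ^ k)).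
    by rewrite rhoh root_prod_XsubC; apply/map_f; rewrite mem_iota.
  rewrite map_poly_comp hs map_prod_XsubC -(big_map pi xpredT (fun w =>
    'X - w%:P)) root_prod_XsubC => /mapP[u us zu].
  have ur : val u \in r by rewrite sr map_f.
  have uQ : val u ^+ Q = val u by apply: eig; rewrite hr root_prod_XsubC.
  have [a ua] : exists a, val u = val z ^+ a.
    suff /prim_rootP : val u ^+ Q.-1 = 1 by case/(_ _ prz) => a ->; exists a.
    have u0 : val u != 0.
      apply: contraTneq isT => u0; have u00 : u = 0 by apply: val_inj.
      have /eqP := zu; rewrite u00 rmorph0 expf_eq0.
      rewrite andbC => /andP[/eqP z0 _]; have /eqP := prim_expr_order prw.
      by rewrite z0 expr0n gtn_eqF ?(ltnW pred_card_gt1) // eq_sym oner_eq0.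
    apply/(mulfI u0).
    by rewrite -exprS prednK ?expn_gt0 ?prime_gt0 // uQ mulr1.
  have ea : u = z ^+ a by apply: val_inj; rewrite rmorphXn.
  have /eqP := zu; rewrite ea rmorphXn (eq_prim_root_expr prw).
  by rewrite -(eq_prim_root_expr prz) => /eqP ->;
    rewrite -ua hr root_prod_XsubC.
rewrite -[RHS]scale1r -(monicP mh); apply: all_roots_prod_XsubC.
- rewrite size_map_inj_poly ?rmorph0 //; last exact: padicInt_embed_inj.
  by rewrite size_char_poly size_map size_iota dE.
- by apply/allP => w /mapP[k + ->]; rewrite mem_iota => kd; apply: mem_roots.
by rewrite uniq_rootsE uniq_frobenius_orbit.
Qed.

End ResidueField.

(** * The kernel of the residue map *)

Lemma padic_poly_scale p (p_pr : prime p) (g : {poly padic p_pr}) :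
  exists k (g0 : {poly padicInt p_pr}), (p ^ k)%:R *: g =
    map_poly (@tofrac _) g0.
Proof.
elim/poly_ind: g => [|g c [k [g0 gk]]].
  by exists 0%N, 0; rewrite scaler0 rmorph0.
have [m [a ca]] := padic_scale _ _ c.
exists (m + k)%N, ((p ^ m)%:R *: g0 * 'X + ((p ^ k)%:R * a)%:P).
rewrite rmorphD rmorphM /= map_polyX map_polyC map_polyZ -gk /= rmorphM
  !rmorph_nat.
rewrite -[X in (_ * X)%:P]ca scalerDr scalerA -scalerAl -natrM -expnD mulrA
  -natrM -expnD (addnC k).
by rewrite polyCM mul_polyC.
Qed.

Section ResidueKernel.

Variables (p : nat) (p_pr : prime p) (p_gt2 : (2 < p)%N).
Variables (Qpbar : closedFieldType) (phi : {rmorphism padic p_pr -> Qpbar}).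
Variables (d : nat) (d_gt0 : (0 < d)%N).
Local Notation Zp := (padicInt p_pr).
Local Notation emb := (padicInt_embed phi).
Local Notation Q := (p ^ d)%N.
Local Notation U := (unramInt phi Q).
Variables (F : finFieldType) (card_F : #|F| = Q) (pi : {rmorphism U -> F}).

Let chF : p \in [pchar F] := residue_pchar p p_pr d F card_F.
Local Notation ofZp := (unram_of_padic p p_pr Qpbar phi Q).

Lemma residue_padic (a : Zp) : pi (ofZp a) = (pdig a 1)%:~R.
Proof.
have [y {1}->] := padic_approx p p_pr a 1.
rewrite !(rmorphD, rmorphM, rmorph_int, rmorph_nat) /= expn1 (pcharf0 chF).
by rewrite mul0r addr0.
Qed.

Lemma residue_padic_eq0 (a : Zp) : pi (ofZp a) = 0 -> exists b, a = p%:R * b.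
Proof.
rewrite residue_padic => /eqP; rewrite -(dvdz_pcharf chF) => /dvdz_mod0P pa.
have [|b ab] := padic_dvdP p p_pr a 1; last by exists b; rewrite expn1 in ab.
by rewrite -padicInt_mod expn1.
Qed.

Lemma prim_root_unram : exists z : U, Q.-1.-primitive_root (val z).
Proof.
have Q_gt1 := pred_card_gt1 p p_gt2 d d_gt0.
have [|z prz] := closed_prim_root_exists Qpbar Q.-1.
  by rewrite (natr_Qpbar_eq0 p p_pr Qpbar phi) -lt0n ltnW.
suff zU : z \in unram_int phi Q by exists (exist _ z zU).
by apply: unram_unity; rewrite ?(ltnW Q_gt1) // unity_rootE prim_expr_order.
Qed.

Lemma residue_poly_eq0 (z : U) (g : {poly Zp}) : Q.-1.-primitive_root (val z) ->
  (size g <= d)%N -> pi (map_poly ofZp g).[z] = 0 ->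
  exists g1, g = p%:R *: g1.
Proof.
move=> prz sg gz; pose rho : {rmorphism Zp -> F} := pi \o ofZp.
have prw := residue_prim _ p_pr p_gt2 _ _ _ d_gt0 _ card_F pi z prz.
(* Residues of p-adic integers are residues of integers, hence fixed by Frobenius; so all conjugates
   of pi(z) will be roots. *)
have gFr : map_poly (pFrobenius_aut chF) (map_poly rho g) = map_poly rho g.
  rewrite -map_poly_comp; apply: eq_map_poly => a /=.
  by rewrite residue_padic rmorph_int.
have rootw k : root (map_poly rho g) (pi z ^+ (p ^ k)).
  elim: k => [|k IHk].
    by rewrite expr1 rootE map_poly_comp horner_map /= gz.
  by rewrite -gFr expnSr exprM -(pFrobenius_autE chF) rmorph_root.
have g0 : map_poly rho g = 0.
  apply/eqP/negPn/negP => gn0.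
  have := max_poly_roots gn0 (rs := [seq pi z ^+ (p ^ k) | k <- iota 0 d]).
  rewrite uniq_frobenius_orbit // size_map size_iota ltnNge.
  rewrite (leq_trans (size_poly _ _)) // => /(_ _ isT) /negP; apply => //.
  by apply/allP => w /mapP[k _ ->].
have /choice[b gb] (k : nat) : exists b, g`_k = p%:R * b.
  by apply: residue_padic_eq0; have := congr1 (fun r : {poly F} => r`_k) g0;
    rewrite coef_map coef0.
exists (\poly_(k < size g) b k); apply/polyP => k.
rewrite coefZ coef_poly; case: ltnP => kg; first exact: gb.
by rewrite mulr0 nth_default.
Qed.

Lemma residue_ker (x : U) : pi x = 0 -> exists y, x = p%:R * y.
Proof.
have [z prz] := prim_root_unram.
have p0 : p%:R != 0 :> Qpbar by rewrite (natr_Qpbar_eq0 p p_pr Qpbar phi) -lt0n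
  prime_gt0.
(* Induction on k: g(z) = p^k x has residue 0, so g = p g1. If k = 0 this is the claim; otherwise a
   factor p cancels and k drops. *)
suff [k [g [sg gx]]] : exists k (g : {poly Zp}),
    (size g <= d)%N /\ (p ^ k)%:R * x = (map_poly ofZp g).[z].
  elim: k g sg x gx => [|k IHk] g sg x gx pix.
    have [|g1 gE] := residue_poly_eq0 z g prz sg; first by rewrite -gx mul1r.
    exists (map_poly ofZp g1).[z].
    by rewrite -[x]mul1r gx gE map_polyZ rmorph_nat hornerZ.
  have [|g1 gE] := residue_poly_eq0 z g prz sg;
    first by rewrite -gx rmorphM pix mulr0.
  apply: (IHk g1) => //.
    rewrite (leq_trans _ sg) // gE size_scale // padic_natr_eq0.
    by rewrite -lt0n prime_gt0.
  apply: val_inj; apply: (mulfI p0).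
  have /(congr1 val) := gx; rewrite gE map_polyZ rmorph_nat hornerZ expnS natrM
    -mulrA.
  by rewrite !(rmorphM val) rmorph_nat.
have [h hz] := frobenius_orbit_poly _ _ p_gt2 _ _ _ d_gt0 _ card_F pi z prz.
have rhz : root (map_poly emb h) (val z).
  rewrite hz root_prod_XsubC; apply/mapP; exists 0%N; first by rewrite mem_iota.
  by rewrite expr1.
pose hp := map_poly (@tofrac _) h : {poly padic p_pr}.
have hpE : map_poly phi hp = map_poly emb h by rewrite -map_poly_comp.
have shp : size hp = d.+1.
  by rewrite -(size_map_poly phi) hpE hz size_prod_XsubC size_map size_iota.
have hp0 : hp != 0 by rewrite -size_poly_gt0 shp.
have algz : algebraicOver phi (val z) by exists hp; rewrite ?hpE.
(* Q_p[z] is a field and contains all (Q-1)-th roots of unity, which are powers of z; hence it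
   contains x. *)
have /asboolP[/(_ _ (adjoin_divring _ _ phi (val z) algz)) xS _] := valP x.
have /asboolP[g xg] : val x \in
    [pred x | `[< exists g, x = (map_poly phi g).[val z] >]].
  apply: xS => [y|y]; last rewrite unity_rootE => /eqP/(prim_rootP prz)[k ->];
    apply/asboolP.
    by exists y%:P; rewrite map_polyC hornerC.
  by exists 'X^k; rewrite map_polyXn hornerXn.
(* Reduction modulo [hp] makes the degree less than d, and a power of p clears the denominators. *)
have [k [g0 gk]] := padic_poly_scale p p_pr (g %% hp).
exists k, g0; split.
  have -> : size g0 = size (map_poly (@tofrac _) g0).
    by rewrite size_map_inj_poly ?rmorph0 // => a b /eqP;
      rewrite tofrac_eq => /eqP.
  by rewrite -gk (leq_trans (size_scale_leq _ _)) // -ltnS -shp ltn_modp.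
apply: val_inj; rewrite rmorphM rmorph_nat [X in _ * X]xg.
have -> : (map_poly phi g).[val z] = (map_poly phi (g %% hp)).[val z].
  rewrite {1}(divp_eq g hp) rmorphD rmorphM hornerD hornerM /= hpE.
  by rewrite (rootP rhz) mulr0 add0r.
rewrite -hornerZ -(rmorph_nat phi) -map_polyZ gk -map_poly_comp.
by rewrite -horner_map -map_poly_comp.
Qed.
End ResidueKernel.

(** * Values of the quasi norm *)

Lemma lift_poly (K L : nzRingType) (f : {rmorphism K -> L}) (g : {poly L}) :
  (forall k, exists c, g`_k = f c) -> exists h, map_poly f h = g.
Proof.
move=> /choice[c gc]; exists (\poly_(k < size g) c k); apply/polyP => k.
rewrite coef_map coef_poly; case: ltnP => kg; first by rewrite gc.
by rewrite /= rmorph0 nth_default.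
Qed.

Lemma lift_mpoly n (K L : nzRingType) (f : {rmorphism K -> L}) (g :
  {mpoly L[n]}) :
  (forall m, exists c, g@_m = f c) -> exists h, map_mpoly f h = g.
Proof.
move=> /choice[c gc]; exists (\sum_(m <- msupp g) c m *: 'X_[m]).
rewrite (raddf_sum (map_mpoly f)) [RHS]mpolyE; apply: eq_bigr => m _.
by rewrite /= map_mpolyZ map_mpolyX -gc.
Qed.

Lemma msym_comp_mpoly (R : comNzRingType) n k (s : 'S_n) (g : {mpoly R[k]})
    (T : k.-tuple {mpoly R[n]}) :
  msym s (g \mPo T) = g \mPo [tuple msym s (tnth T a) | a < k].
Proof.
rewrite !comp_mpolyE raddf_sum; apply: eq_bigr => m _.
rewrite /= msymZ rmorph_prod; congr (_ *: _); apply: eq_bigr => a _.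
by rewrite rmorphXn tnth_mktuple.
Qed.

(** The product over j of the polynomials G(X_j^(a_1), ..., X_j^(a_N)) is symmetric in the X_j. *)
Lemma prod_over_orbit_image (K L : fieldType) (f : {rmorphism K -> L}) n N
    (ws : n.-tuple L) (h : {poly K}) (G : {mpoly K[N]}) (a : 'I_N -> nat) :
  map_poly f h = \prod_(w <- ws) ('X - w%:P) ->
  exists y, \prod_(j < n) (map_mpoly f G).@[fun k => tnth ws j ^+ a k] = f y.
Proof.
move=> hws; pose T j := [tuple ('X_j : {mpoly K[n]}) ^+ a k | k < N].
pose P := \prod_(j < n) (G \mPo T j).
have Psym : P \is symmetric.
  apply/issymP => s; rewrite rmorph_prod (reindex_inj (@perm_inj _ s^-1)%g) /=.
  apply: eq_bigr => j _; rewrite msym_comp_mpoly; congr (_ \mPo _).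
  apply: eq_from_tnth => k; rewrite !tnth_mktuple rmorphXn /= msymX.
  congr (_ ^+ _); congr ('X_[_]); apply/mnmP => c.
  by rewrite !mnmE (inj_eq perm_inj).
have [y yE] := symmetric_roots_image _ _ f _ ws h P hws Psym.
exists y; rewrite -yE !rmorph_prod /=; apply: eq_bigr => j _.
rewrite map_mpoly_comp; last exact: fmorph_inj.
rewrite comp_mpoly_meval; apply: meval_eq => k.
by rewrite tnth_map tnth_mktuple !rmorphXn /= map_mpolyX mevalXU.
Qed.

Section QuasiNormInvariant.

Variables (p : nat) (p_pr : prime p) (p_gt2 : (2 < p)%N).
Variables (Qpbar : closedFieldType) (phi : {rmorphism padic p_pr -> Qpbar}).
Variables (r i : nat) (r_gt0 : (0 < r)%N) (i_gt0 : (0 < i)%N).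
Local Notation q := (p ^ r)%N.
Local Notation emb := (padicInt_embed phi).
Variable z : Qpbar.
Hypothesis prz : (p ^ (r * i)).-1.-primitive_root z.
Variable h : {poly padicInt p_pr}.
Hypothesis hz : map_poly emb h =
  \prod_(w <- [seq z ^+ (p ^ k) | k <- iota 0 (r * i)]) ('X - w%:P).

(** Raising to the power [e] is the norm map from mu_(q^i-1) to mu_(q-1). *)
Let e := ((p ^ (r * i)).-1 %/ q.-1)%N.

Lemma prim_sub_root : q.-1.-primitive_root (z ^+ e).
Proof.
have qn : (q.-1 %| (p ^ (r * i)).-1)%N by rewrite expnM dvdn_pred_predX.
have -> : q.-1 = ((p ^ (r * i)).-1 %/ gcdn e (p ^ (r * i)).-1)%N.
  have eE : (e * q.-1)%N = (p ^ (r * i)).-1 by rewrite divnK.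
  have n0 := prim_order_gt0 prz; rewrite -eE muln_gt0 in n0.
  by rewrite -eE (gcdn_idPl (dvdn_mulr _ (dvdnn _))) mulKn //; case/andP: n0.
exact: exp_prim_root.
Qed.

(** The e-th power of z^(p^k) is (z^e)^(p^k). As z^e has order p^r - 1, this equals z^e exactly when
    r divides k. *)
Lemma frobenius_suborbit :
  perm_eq [seq w <- [seq z ^+ (p ^ k) | k <- iota 0 (r * i)] | w ^+ e == z ^+ e]
          [seq z ^+ (q ^ k) | k <- iota 0 i].
Proof.
apply: uniq_perm.
- by rewrite filter_uniq // uniq_frobenius_orbit.
- rewrite map_inj_in_uniq ?iota_uniq // => a b;
  rewrite !mem_iota /= !add0n => ai bi.
  rewrite -!expnM => /(frobenius_orbit_inj _ _ _ _ p_gt2 prz).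
  rewrite !mem_iota /= !add0n !ltn_pmul2l // => /(_ ai bi) /eqP.
  by rewrite eqn_pmul2l // => /eqP.
have zq k : (z ^+ e) ^+ (q ^ k) = z ^+ e.
  elim: k => [|k IHk]; first by rewrite expr1.
  rewrite expnS exprM -[in RHS]IHk; congr (_ ^+ _).
  rewrite -[q in LHS]prednK ?expn_gt0 ?prime_gt0 // exprS.
  by rewrite (prim_expr_order prim_sub_root) mulr1.
move=> x; rewrite mem_filter; apply/andP/mapP => [[xe /mapP[k]]|[k]].
  rewrite mem_iota => /= kri xk; exists (k %/ r)%N.
    by rewrite mem_iota /= add0n ltn_divLR // mulnC.
  suff kr : (k %% r)%N = 0%N by rewrite xk {1}(divn_eq k r) kr addn0 mulnC
    expnM.
  apply: (frobenius_orbit_inj _ _ _ _ p_gt2 prim_sub_root).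
  - by rewrite mem_iota /= add0n ltn_mod.
  - by rewrite mem_iota.
  rewrite expn0 expr1 -[RHS](eqP xe) xk -exprM mulnC exprM.
  by rewrite {2}(divn_eq k r) expnD mulnC (mulnC (k %/ r)%N) expnM mulnC exprM
    zq.
rewrite mem_iota => /= ki ->; split.
  by rewrite -exprM mulnC exprM zq.
by apply/mapP; exists (r * k)%N; rewrite ?expnM // mem_iota /= add0n ltn_pmul2l.
Qed.

Lemma quasi_norm_cyclotomic N (G : {mpoly Qpbar[N]}) (a : 'I_N -> nat) :
    (forall m, in_cyclotomic phi q.-1 G@_m) ->
  in_cyclotomic phi q.-1 (\prod_(j < i) G.@[fun k => z ^+ (q ^ j) ^+ a k]).
Proof.
move=> Gq S Sf SQp Smu; have [K [f [fS Sf']]] := subfield_of_pred _ _ Sf.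
(* The whole argument descends to the subfield S: it contains the coefficients of G and h, and also
   z^e, a (q-1)-th root of unity. *)
have [GK GE] : exists GK, map_mpoly f GK = G.
  by apply: lift_mpoly => m; apply: fS; apply: Gq.
have [hK hE] : exists hK, map_poly f hK = map_poly emb h.
  by apply: lift_poly => k; rewrite coef_map; apply: fS; apply: SQp.
have [y yE] : exists y, z ^+ e = f y.
  by apply: fS; apply: Smu; rewrite unity_rootE prim_expr_order ?prim_sub_root.
pose ws := [tuple z ^+ (q ^ j) | j < i].
have [g gE] : exists g, map_poly f g = \prod_(w <- ws) ('X - w%:P).
  have [|g gE] := common_roots_image _ _ f hK ('X^e - y%:P) _ _ (etrans hE hz).
    exact: uniq_frobenius_orbit.
  exists g; rewrite gE -big_filter.
  have -> : tval ws = [seq z ^+ (q ^ k) | k <- iota 0 i].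
    by rewrite -val_enum_ord -map_comp.
  rewrite -(perm_big _ frobenius_suborbit) /=; congr bigop.
  apply: eq_filter => w.
  by rewrite rootE rmorphB /= map_polyXn map_polyC hornerD hornerN hornerXn
             hornerC /= -yE subr_eq0.
have [c cE] := prod_over_orbit_image _ _ f _ _ ws g GK a gE.
suff -> : \prod_(j < i) G.@[fun k => z ^+ (q ^ j) ^+ a k] = f c by [].
rewrite -cE GE; apply: eq_bigr => j _; apply: meval_eq => k.
by rewrite tnth_mktuple.
Qed.
End QuasiNormInvariant.

(** * The binomial matrix *)

Lemma coef_1DXn (R : comNzRingType) n k :
  ((1 + 'X) ^+ n : {poly R})`_k = 'C(n, k)%:R.
Proof.
elim: n k => [|n IHn] k; first by rewrite coef1 bin0n; case: k.
rewrite exprS mulrDl mul1r coefD coefXM !IHn.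
by case: k => [|k] /=; rewrite ?bin0 ?addr0 // binS natrD.
Qed.

Definition binom_mx_int (l b : nat) : 'M[int]_l :=
  \matrix_(j, k) 'C(b + 2 * j, k)%:R.

(* Expanding (1 + X) ^ (b + 2 j) = (1 + (2 X + X^2)) ^ j (1 + X) ^ b factors
   the matrix into two triangular ones. *)
Lemma det_binom_mx_int (l b : nat) : exists K, \det (binom_mx_int l b) = 2 ^+ K.
Proof.
pose w : {poly int} := 'X *+ 2 + 'X ^+ 2.
pose A : 'M[int]_l := \matrix_(j, t) 'C(j, t)%:R.
pose B : 'M[int]_l := \matrix_(t, k) (w ^+ t * (1 + 'X) ^+ b)`_k.
have -> : binom_mx_int l b = A *m B.
  apply/matrixP => j k; rewrite !mxE -coef_1DXn exprD mulrC exprM.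
  have -> : (1 + 'X) ^+ 2 = 1 + w :> {poly int}.
    by rewrite sqrrD expr1n mul1r -addrA.
  rewrite exprDn (big_ord_widen l (fun t => 1 ^+ (j - t) * w ^+ t *+ 'C(j, t)))
    //.
  rewrite big_mkcond mulr_suml coef_sum; apply: eq_bigr => t _; rewrite !mxE.
  case: ltnP => [_|jt]; last by rewrite bin_small // mul0r mulr0n mul0r coef0.
  by rewrite expr1n mul1r [in LHS]mulrnAl coefMn mulr_natl.
exists (\sum_(t < l) t)%N; rewrite det_mulmx det_trig; last first.
  by apply/is_trig_mxP => j t jt; rewrite mxE bin_small.
rewrite big1 ?mul1r => [|j _]; last by rewrite mxE binn.
(* Row t of B lists the coefficients of X^t (2 + X)^t (1 + X)^b, so B is upper triangular with
   diagonal entries 2^t. *)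
have wE : w = 'X * (2%:R + 'X) by rewrite mulrDr mulr_natr.
rewrite -det_tr det_trig; last first.
  apply/is_trig_mxP => k t kt; rewrite !mxE wE exprMn -mulrA coefXnM.
  by rewrite kt.
rewrite expr_sum; apply: eq_bigr => t _.
rewrite !mxE wE exprMn -mulrA coefXnM ltnn subnn -horner_coef0.
by rewrite !hornerE expr1n mulr1.
Qed.

(** Take for u the first row of the adjugate. Division by the determinant 2^K gives the
    coefficients, and the product of the adjugate with the matrix gives the relations. *)
Lemma eulerian_coef_int (l : nat) (l_gt0 : (0 < l)%N) (b : nat) :
  exists K (u : 'I_l -> int),
    (forall k, eulerian_coef l_gt0 b k * 2 ^+ K = (u k)%:~R) /\
    (forall m : 'I_l, \sum_k u k * 'C(b + 2 * k, m)%:R =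
      2 ^+ K * (m == 0 :> nat)%:R).
Proof.
have [K detP] := det_binom_mx_int l b.
pose o := Ordinal l_gt0; exists K, (fun k => (\adj (binom_mx_int l b)) o k);
  split=> [k|m].
  have PE : binom_mx l b = map_mx intr (binom_mx_int l b).
    by apply/matrixP => j m; rewrite !mxE -PoszD binz_nat rmorph_nat.
  have dP : \det (binom_mx l b) = 2 ^+ K by rewrite PE det_map_mx detP rmorphXn.
  have uP : binom_mx l b \in unitmx by rewrite unitmxE dP unitfE expf_neq0.
  rewrite /eulerian_coef /invmx uP mxE dP mulrAC mulVf ?expf_neq0 // mul1r.
  by rewrite PE -map_mx_adj mxE.
have := congr1 (fun M : 'M_l => M o m) (mul_adj_mx (binom_mx_int l b)).
rewrite [LHS]mxE [RHS]mxE detP => e.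
have -> : (m == 0 :> nat) = (o == m) by rewrite eq_sym.
by rewrite mulr_natr -[RHS]e; apply: eq_bigr => k _; congr (_ * _); rewrite mxE.
Qed.

Lemma ratr_scaled (L : fieldType) (x : rat) (n : nat) (u : int) :
    (forall k, (k%:R == 0 :> L) = (k == 0)%N) ->
  x * n%:R = u%:~R -> ratr x * n%:R = u%:~R :> L.
Proof.
move=> charL xn; have d0 : (denq x)%:~R != 0 :> L.
  by have := denq_gt0 x; case: (denq x) => // d; rewrite charL -lt0n.
apply: (mulfI d0); rewrite /ratr mulrA [_ * (_ / _)]mulrC divfK //.
have : (numq x * n%:R)%:~R = (denq x * u)%:~R :> rat.
  by rewrite !rmorphM /= -xn rmorph_nat mulrA [in RHS](mulrC (denq x)%:~R)
    numqE.
by move=> /intr_inj e; rewrite -[n%:R in LHS](rmorph_nat intr) -!rmorphM /= e.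
Qed.

(** * The congruence *)

Lemma exprDn_trunc (R : comNzRingType) (v : R) n l :
  exists t, (1 + v) ^+ n = \sum_(m < l) v ^+ m * 'C(n, m)%:R + v ^+ l * t.
Proof.
exists (\sum_(m < n.+1) v ^+ m * 'C(n, l + m)%:R).
rewrite exprDn (big_ord_widen (l + n.+1) (fun m => 1 ^+ (n - m) * v ^+ m *+
  'C(n, m))) ?leq_addl //.
rewrite big_mkcond big_split_ord mulr_sumr; congr (_ + _);
  apply: eq_bigr => m _ /=;
  rewrite expr1n mul1r mulr_natr.
  by case: ltnP => // nm; rewrite bin_small.
rewrite exprD -mulrnAr; case: ltnP => // nm.
by rewrite bin_small // mulr0n mulr0.
Qed.

(** The exponents are odd, so eps factors out of all powers of x = eps (1 + v). After exchange of
    the sums, the relations on u cancel v^m for 0 < m < l and leave 2^K, which half^K absorbs; the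
    rest is divisible by v^l, hence by p^l. *)
Lemma eulerian_sum_congr (R : comNzRingType) (p l b K : nat) (u : 'I_l -> int)
    (half x eps y : R) :
    odd b -> (0 < l)%N -> half * 2 = 1 -> eps ^+ 2 = 1 -> x = eps + p%:R * y ->
    (forall m : 'I_l, \sum_k u k * 'C(b + 2 * k, m)%:R =
      2 ^+ K * (m == 0 :> nat)%:R) ->
  exists t, \sum_k (u k)%:~R * half ^+ K * x ^+ (b + 2 * k) - eps =
    (p ^ l)%:R * t.
Proof.
move=> b_odd l_gt0 half2 eps2 xE uP.
pose v := p%:R * (eps * y).
have {}xE : x = eps * (1 + v).
  by rewrite mulrDr mulr1 /v (mulrCA eps) (mulrA eps) -expr2 eps2 mul1r.
have epsb k : eps ^+ (b + 2 * k) = eps.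
  rewrite exprD exprM eps2 expr1n mulr1 -(odd_double_half b) b_odd -mul2n.
  by rewrite exprD exprM eps2 expr1n mulr1.
have /choice[t tE] (k : 'I_l) := exprDn_trunc R v (b + 2 * k) l.
exists ((eps * y) ^+ l * (eps * half ^+ K * \sum_k (u k)%:~R * t k)).
transitivity (eps * half ^+ K * (\sum_k (u k)%:~R * (1 + v) ^+ (b + 2 * k)) -
  eps).
  congr (_ - _); rewrite mulr_sumr; apply: eq_bigr => k _.
  by rewrite xE exprMn epsb; ring.
have -> : \sum_k (u k)%:~R * (1 + v) ^+ (b + 2 * k) =
    2 ^+ K + v ^+ l * \sum_k (u k)%:~R * t k.
  under eq_bigr => k _ do rewrite tE mulrDr.
  rewrite big_split /= mulr_sumr; congr (_ + _); last first.
    by apply: eq_bigr => k _; rewrite mulrCA.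
  under eq_bigr => k _ do rewrite mulr_sumr.
  rewrite exchange_big /= (bigD1 (Ordinal l_gt0)) //= [X in _ + X]big1 =>
    [|m m0].
    rewrite addr0; transitivity ((2 ^+ K * 1 : int)%:~R : R); last first.
      by rewrite mulr1 rmorphXn.
    rewrite -(uP (Ordinal l_gt0)) rmorph_sum.
    by apply: eq_bigr => k _; rewrite mul1r rmorphM /= natz.
  transitivity (v ^+ m * (\sum_k u k * 'C(b + 2 * k, m)%:R)%:~R).
    rewrite rmorph_sum mulr_sumr; apply: eq_bigr => k _.
    by rewrite rmorphM /= natz mulrCA.
  have m0' : (m == 0 :> nat) = false by apply/negbTE.
  by rewrite uP m0' mulr0 mulr0.
rewrite mulrDr -mulrA -exprMn half2 expr1n mulr1 addrC addKr /v natrX exprMn.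
by ring.
Qed.

(** The square of v^e is 1. If v = w^k and v^e = 1, then 2e divides k e, so k is even and v is a
    square. *)
Lemma euler_criterion (F : finFieldType) (e : nat) (w v : F) :
    #|F|.-1.-primitive_root w -> #|F|.-1 = (2 * e)%N -> v != 0 ->
  ((exists y, v = y ^+ 2) -> v ^+ e = 1) /\
  (~ (exists y, v = y ^+ 2) -> v ^+ e = -1).
Proof.
move=> prw Fe v0.
have fermat (y : F) : y != 0 -> y ^+ (2 * e) = 1.
  move=> y0; apply: (mulfI y0); rewrite mulr1 -exprS -Fe prednK ?expf_card //.
  by apply/card_gt0P; exists y.
have [k vk] : exists k, v = w ^+ k.
  by have [|k ->] := prim_rootP prw (x := v); [rewrite Fe fermat|exists k].
split=> [[y vy]|nsq].
  rewrite vy -exprM fermat //; apply: contraNneq v0 => y0.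
  by rewrite vy y0 expr0n.
have /eqP : (v ^+ e) ^+ 2 = 1 by rewrite -exprM mulnC fermat.
rewrite sqrf_eq1 => /orP[|/eqP //]; rewrite vk -exprM -(prim_order_dvd prw) Fe
  mulnC.
have e_gt0 : (0 < e)%N by have := prim_order_gt0 prw; rewrite Fe muln_gt0.
rewrite (mulnC k) dvdn_pmul2l // => /dvdnP[c kc]; case: nsq.
by exists (w ^+ c); rewrite vk kc exprM.
Qed.

Lemma meval_map_quasi_power (R S : comNzRingType) (f : {rmorphism R -> S}) N n
    (v : 'I_N -> S) (g : {mpoly R[N]}) : injective f ->
  (map_mpoly f (quasi_power n g)).@[v] = (map_mpoly f g).@[fun k => v k ^+ n].
Proof.
move=> f_inj; rewrite map_mpoly_comp // comp_mpoly_meval; apply: meval_eq => k.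
by rewrite tnth_map tnth_mktuple !rmorphXn /= map_mpolyX mevalXU.
Qed.

(** The p^n-th power is additive in characteristic p and fixes the coefficients of g. *)
Lemma meval_frobenius (F : fieldType) p n N (g : {mpoly F[N]}) (v : 'I_N -> F) :
    p \in [pchar F] -> (forall m, g@_m ^+ (p ^ n) = g@_m) ->
  g.@[fun k => v k ^+ (p ^ n)] = g.@[v] ^+ (p ^ n).
Proof.
move=> chF gn; rewrite !mevalE.
have pn0 : (0 < p ^ n)%N by rewrite expn_gt0 (prime_gt0 (pcharf_prime chF)).
rewrite (big_morph (fun x => x ^+ (p ^ n)) (id1 := 0) (op1 := +%R)).
- apply: eq_bigr => m _; rewrite exprMn gn -prodrXl; congr (_ * _).
  by apply: eq_bigr => k _; rewrite -!exprM mulnC.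
- move=> x y; apply: exprDn_pchar; rewrite pnatX (eq_pnat _ (pcharf_eq chF)).
  by rewrite pnat_id // (pcharf_prime chF).
by rewrite expr0n gtn_eqF.
Qed.

(** * Inclusions between the rings of integers *)

Section Inclusion.

Variables (p : nat) (p_pr : prime p).
Variables (Qpbar : closedFieldType) (phi : {rmorphism padic p_pr -> Qpbar}).
Variables (m n : nat) (mn : (m.-1 %| n.-1)%N).

Fact unram_incl_subproof (x : unramInt phi m) : val x \in unram_int phi n.
Proof.
have /asboolP[xS xZ] := valP x; apply/asboolP; split=> // S Sf SQp Smu.
apply: xS => // w; rewrite unity_rootE => /eqP wm; apply: Smu.
by rewrite unity_rootE -(divnK mn) mulnC exprM wm expr1n.
Qed.

Definition unram_incl (x : unramInt phi m) : unramInt phi n :=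
  exist _ (val x) (unram_incl_subproof x).

Fact unram_incl_zmod : zmod_morphism unram_incl.
Proof. by move=> x y; apply: val_inj. Qed.

Fact unram_incl_monoid : GRing.monoid_morphism unram_incl.
Proof. by split=> [|x y]; apply: val_inj. Qed.

HB.instance Definition _ :=
  GRing.isZmodMorphism.Build _ _ unram_incl unram_incl_zmod.
HB.instance Definition _ :=
  GRing.isMonoidMorphism.Build _ _ unram_incl unram_incl_monoid.

End Inclusion.

Theorem theorem4p4
  (p : nat) (p_pr : prime p) (p_odd : odd p)
  (q : nat) (q_pow : exists2 r : nat, (0 < r)%N & q = (p ^ r)%N)
  (N l i : nat) (N_gt0 : (0 < N)%N) (l_gt0 : (0 < l)%N) (i_gt0 : (0 < i)%N)
  (Qpbar : closedFieldType) (iota : {rmorphism padic p_pr -> Qpbar})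
  (Qpbar_alg : is_algebraic_closure iota)
  (Fq Fqi : finFieldType) (card_Fq : #|Fq| = q) (card_Fqi : #|Fqi| = (q ^ i)%N)
  (piq : {rmorphism unramInt iota q -> Fq}) (piq_res : is_residue_map piq)
  (pi : {rmorphism unramInt iota (q ^ i) -> Fqi}) (pi_res : is_residue_map pi)
  (j : {rmorphism Fq -> Fqi})
  (j_incl : forall (x : unramInt iota q) (y : unramInt iota (q ^ i)),
      val x = val y -> j (piq x) = pi y)
  (f : {mpoly Fq[N]}) (F : {mpoly (unramInt iota q)[N]})
  (F_lift : map_mpoly piq F = f)
  (b : int) (b_odd : ~~ (2 %| b)%Z)
  (b_ge : l%:Z <= (b * (q%:Z - 1) %/ 2)%Z) :
  is_eulerian l j pi f (fun z => (eulerian_poly i l_gt0 b F).@[z]).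
Proof.
have p_gt2 : (2 < p)%N by rewrite odd_prime_gt2.
case: q_pow => r r_gt0 q_pow.
have d_gt0 : (0 < r * i)%N by rewrite muln_gt0 r_gt0.
have qQ : (q.-1 %| (q ^ i).-1)%N by rewrite dvdn_pred_predX.
have q_gt1 : (1 < q)%N by rewrite -card_Fq card_finNzRing_gt1.
have QE : (p ^ (r * i) = q ^ i)%N by rewrite q_pow expnM.
pose incl := unram_incl p p_pr Qpbar iota q (q ^ i) qQ.
have chFq : p \in [pchar Fq] by exact: card_finPcharP (etrans card_Fq q_pow)
  p_pr.
have chFqi : p \in [pchar Fqi] by exact: card_finPcharP (etrans card_Fqi (esym
  QE)) p_pr.
have [e qe] : exists e, q.-1 = (2 * e)%N.
  exists (q.-1)./2; rewrite mul2n even_halfK //.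
  by have := oddX p r; rewrite p_odd orbT -q_pow -{1}(ltn_predK q_gt1) /= =>
    /negbTE ->.
have divE (x : int) : (x * (q%:Z - 1) %/ 2)%Z = x * e%:Z.
  have -> : q%:Z - 1 = (e * 2)%N%:Z.
    by rewrite mulnC -qe -[in LHS](ltn_predK q_gt1) -addn1 PoszD addrK.
  by rewrite PoszM mulrA mulzK.
(* As l > 0, the lower bound on b (q - 1) / 2 forces b to be positive. *)
have [b' [bE bo bl]] : exists b' : nat, [/\ b = b', odd b' & (l <= b' * e)%N].
  move: b_ge; rewrite divE; case: b b_odd => n n_odd nl.
    by exists n; split=> //; move: n_odd; rewrite dvdzE /= dvdn2 negbK.
  have : Negz n * e%:Z <= 0 by rewrite NegzE mulNr oppr_le0.
  by move/(le_trans nl); rewrite lez_nat leqNgt l_gt0.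
have expE k : `|((b + (2 * k)%N%:Z) * (q%:Z - 1) %/ 2)%Z|%N =
  ((b' + 2 * k) * e)%N.
  by rewrite divE bE.
(* A generator of mu_(q^i-1): the coordinates of every point are powers of it. *)
have [z0 prz0] : exists z : unramInt iota (q ^ i), (q ^ i).-1.-primitive_root
  (val z).
  have := prim_root_unram p p_pr p_gt2 Qpbar iota (r * i) d_gt0; rewrite QE;
    exact.
have prw0 : (q ^ i).-1.-primitive_root (pi z0).
  have := residue_prim p p_pr p_gt2 Qpbar iota (r * i) d_gt0; rewrite QE.
  by move/(_ Fqi card_Fqi pi); apply.
have [h hz0] : exists h : {poly padicInt p_pr}, map_poly (padicInt_embed iota) h
  =
    \prod_(w <- [seq val z0 ^+ (p ^ k) | k <- seq.iota 0 (r * i)]) ('X - w%:P).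
  have := frobenius_orbit_poly p p_pr p_gt2 Qpbar iota (r * i) d_gt0;
    rewrite QE.
  by move/(_ Fqi card_Fqi pi z0); apply.
have ker_piq x : piq x = 0 -> exists y, x = p%:R * y.
  have := residue_ker p p_pr p_gt2 Qpbar iota r r_gt0; rewrite -q_pow.
  by move/(_ Fq card_Fq piq); apply.
have [half half2] : exists half : unramInt iota q, half * 2 = 1.
  have [|y y2] := padic_invertible p p_pr 2%:R.
    by rewrite -[2%:R]/((2 : int)%:~R) pdig_int expn1 modz_small.
  exists (unram_of_padic p p_pr Qpbar iota q y).
  by rewrite -(rmorph_nat (unram_of_padic p p_pr Qpbar iota q)) -rmorphM y2
    rmorph1.
move=> z z_unity v.
have /choice[a za] (k : 'I_N) : exists c : nat, z k = z0 ^+ c.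
  have := z_unity k; rewrite unity_rootE => /eqP zk.
  have [|a zka] := prim_rootP prz0 (x := val (z k)).
    by rewrite -rmorphXn zk rmorph1.
  by exists a; apply: val_inj; rewrite rmorphXn.
(* AQ and A are the value of the quasi norm of F at z, seen in Z_(q^i) and in
   Z_q respectively. *)
pose AQ := \prod_(c < i) (map_mpoly incl F).@[fun k => z k ^+ (q ^ c)].
pose G := map_mpoly val F.
have valAQ : val AQ = \prod_(c < i) G.@[fun k => val z0 ^+ (q ^ c) ^+ a k].
  rewrite rmorph_prod; apply: eq_bigr => c _; rewrite -(meval_map _ _ val).
  have -> : map_mpoly val (map_mpoly incl F) = G.
    by apply/mpolyP => m; rewrite !mcoeff_map_mpoly.
  by apply: meval_eq => k; rewrite za !rmorphXn -!exprM mulnC.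
(* Integrality is inherited from Z_(q^i); membership in Q_p(mu_(q-1)) is the symmetry argument of
   [quasi_norm_cyclotomic]. *)
have [A valA] : exists A : unramInt iota q, val A = val AQ.
  have AU : val AQ \in unram_int iota q; last first.
    by exists (exist (fun x => x \in unram_int iota q) _ AU).
  apply/asboolP; split; last by have /asboolP[] := valP AQ.
  have := quasi_norm_cyclotomic p p_pr p_gt2 Qpbar iota r i r_gt0 (val z0).
  rewrite QE -q_pow valAQ => /(_ prz0 h hz0 N G a); apply => m.
  by rewrite mcoeff_map_mpoly; have /asboolP[] := valP F@_m.
have map_pi : map_mpoly pi (map_mpoly incl F) = map_mpoly j f.
  apply/mpolyP => m; rewrite -F_lift !mcoeff_map_mpoly.
  by symmetry; apply: j_incl.
(* The coefficients of f lie in F_q, so the factor of index c reduces to v^(q^c). *)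
have piAQ : pi AQ = v ^+ (\sum_(c < i) q ^ c).
  rewrite rmorph_prod expr_sum; apply: eq_bigr => c _.
  have qc : (q ^ c = p ^ (r * c))%N by rewrite q_pow expnM.
  rewrite -meval_map map_pi qc -(meval_frobenius _ _ _ _ _ _ chFqi).
    by apply: meval_eq => k; rewrite rmorphXn -qc.
  move=> m; rewrite mcoeff_map_mpoly -rmorphXn -qc; congr (j _).
  elim: (c : nat) => [|k IHk]; first by rewrite expr1.
  by rewrite expnSr exprM IHk -[in LHS]card_Fq expf_card.
have jA : j (piq A) = v ^+ (\sum_(c < i) q ^ c) by rewrite -piAQ; apply: j_incl.
have valQ n : (map_mpoly val (quasi_norm q i (F ^+ n))).@[fun k => val (z k)] =
  val A ^+ n.
  rewrite valA valAQ -prodrXl !rmorph_prod; apply: eq_bigr => c _.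
  transitivity (map_mpoly val (quasi_power (q ^ c) (F ^+ n))).@[fun k =>
    val (z k)] => //.
  rewrite (meval_map_quasi_power _ _ val); last exact: val_inj.
  rewrite !rmorphXn; congr (_ ^+ _); apply: meval_eq => k.
  by rewrite za rmorphXn -!exprM mulnC.
have [K [u [uE uP]]] := eulerian_coef_int l l_gt0 b'.
(* The coefficient of index k is u_k / 2^K; [half] expresses it inside Z_q. *)
pose s := \sum_k (u k)%:~R * half ^+ K * (A ^+ e) ^+ (b' + 2 * k).
have sE : (eulerian_poly i l_gt0 b F).@[fun k => val (z k)] = val s.
  rewrite /eulerian_poly !rmorph_sum; apply: eq_bigr => k _.
  rewrite [LHS]/= mevalZ expE valQ bE !(rmorphM val) !(rmorphXn val) rmorph_int
    -exprM.
  rewrite (mulnC e); congr (_ * _).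
  have two0 : 2 ^+ K != 0 :> Qpbar.
    by rewrite expf_neq0 // (natr_Qpbar_eq0 p p_pr Qpbar iota).
  apply: (mulIf two0); rewrite -[RHS]mulrA -exprMn.
  have /(congr1 val) := half2; rewrite rmorphM rmorph_nat rmorph1 => ->.
  rewrite expr1n mulr1 -natrX; apply: ratr_scaled;
    first exact: (natr_Qpbar_eq0 p p_pr Qpbar iota).
  by rewrite natrX uE.
(* (q^i - 1) / 2 is e times the norm exponent, so Euler's criterion for v determines the residue of
   A^e. *)
have Qe : (#|Fqi|.-1 = 2 * (e * \sum_(c < i) q ^ c))%N.
  by rewrite card_Fqi predn_exp qe mulnA.
have prw : #|Fqi|.-1.-primitive_root (pi z0) by rewrite card_Fqi.
have piqx eps : (v ^+ (e * \sum_(c < i) q ^ c) = eps%:~R) ->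
    exists y, A ^+ e = eps%:~R + p%:R * y.
  move=> veps; have [|y yE] := ker_piq (A ^+ e - eps%:~R).
    apply: (fmorph_inj j); rewrite rmorph0 !rmorphB rmorphXn !rmorph_int
      rmorphXn.
    by rewrite jA -exprM mulnC veps subrr.
  by exists y; rewrite -yE addrC subrK.
exists s; split=> // [v0 vsq|v0 vnsq|v0].
- have [/(_ vsq) ve _] := euler_criterion _ _ _ _ prw Qe v0.
  have [y yE] := piqx 1 ve.
  by have [t tE] := eulerian_sum_congr _ p l b' K u half _ 1 y bo l_gt0 half2
    (expr1n _ 2) yE uP; exists t.
- have [_ /(_ vnsq) ve] := euler_criterion _ _ _ _ prw Qe v0.
  have [y yE] := piqx (-1) ve.
  by have [t tE] := eulerian_sum_congr _ p l b' K u half _ (-1) y bo l_gt0 half2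
    (sqrr_sign _ 1) yE uP; exists t.
(* The residue of A is a power of v = 0 with positive exponent, since i > 0 and the term c = 0 is
   1. *)
have [y yE] : exists y, A = p%:R * y.
  apply: ker_piq; apply: (fmorph_inj j); rewrite rmorph0 jA v0 expr0n.
  by rewrite -(prednK i_gt0) big_ord_recl.
(* The bound on b makes every exponent (b + 2 k) e at least l, so p^l splits off from each power of
   A. *)
exists (\sum_k (u k)%:~R * half ^+ K * (y ^+ l * A ^+ ((b' + 2 * k) * e - l))).
rewrite subr0 mulr_sumr; apply: eq_bigr => k _.
have lk : (l <= (b' + 2 * k) * e)%N by rewrite (leq_trans bl) // leq_mul2r
  leq_addr orbT.
rewrite -exprM mulnC -{1}(subnKC lk) exprD {1}yE exprMn natrX.
ring.
Qed.
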